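(* Let $P$ be the transition probability matrix of an irreducible, aperiodic, positive recurrent $GI/G/1$-type Markov chain with blocks $A_k,B_k$ (as described in the context). Assume that $A=\sum_{k=-\infty}^{\infty}A_k$ is stochastic and that $\phi_{A+}>1$. Then for every $z$ with $1<z<\min(\phi_{A+},\eta)$ one has $\chi(z)<1$, and there exists a Perron–Frobenius eigenvector $\mathbf{Y}(z)$ with $\mathbf{Y}(z)\ge\mathbf{e}^t$ (entrywise) such that $$A^*(z)\mathbf{Y}(z)=\chi(z)\mathbf{Y}(z).$$
   Context: A $GI/G/1$-type Markov chain is a discrete-time Markov chain on the state space $\bigcup_{i\ge0}L_i$, $L_i=\{(i,j):j=1,\dots,m\}$, whose stochastic transition matrix $P$ has $m\times m$ blocks $P_{i,k}$ (transitions from level $i$ to level $k$) given by $P_{0,k}=B_k$ for $k\ge0$, $P_{i,0}=B_{-i}$ for $i\ge1$, and $P_{i,k}=A_{k-i}$ for $i,k\ge1$, where $A_k,B_k$ ($k\in\mathbb{Z}$) are nonnegative $m\times m$ matrices. Standing assumption: $A=\sum_{k=-\infty}^{\infty}A_k$ is irreducible. $\mathbf{e}$ is the row vector of ones, $\mathbf{e}^t$ its transpose. $A^*(z)=\sum_{k=-\infty}^{\infty}z^kA_k$. $\phi_{A+}$ is the minimum over $(r,s)$ of the radii of convergence of the $(r,s)$ entries of $A^*_+(z)=\sum_{k\ge1}A_kz^k$. For real $z>0$ for which $A^*(z)$ converges, $\chi(z)$ is the largest (Perron–Frobenius) eigenvalue of $A^*(z)$. Let $\Omega=\{z\in\mathbb{C}:1<|z|<\phi_{A+},\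 \det(I-A^*(z))=0\}$. If $\Omega\ne\emptyset$, it is known that there is a positive real $z_0\in\Omega$ with $z_0\le|z|$ for all $z\in\Omega$, and $\eta:=z_0$; if $\Omega=\emptyset$, $\eta:=\infty$. *)

(* Defs.v *)
From HB Require Import structures.
From mathcomp Require Import all_boot all_order all_algebra.
From mathcomp Require Import all_classical all_reals all_analysis.
From mathcomp Require Export complex.
Set Implicit Arguments.
Unset Strict Implicit.
Unset Printing Implicit Defensive.
Import Order.TTheory GRing.Theory Num.Theory.
Import numFieldNormedType.Exports.
Local Open Scope classical_set_scope.
Local Open Scope ring_scope.
Local Open Scope complex_scope.

(* Transition matrices on a (countable) state space T. Sums over T of
   nonnegative terms are taken in the extended reals. *)
Section MarkovChain.
Context {R : realType} {T : choiceType}.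
Implicit Types (P : T -> T -> R) (x y : T) (n : nat).
Local Open Scope ereal_scope.

Definition stochastic_kernel P :=
  (forall x y, (0 <= P x y)%R) /\
  (forall x, \esum_(y in [set: T]) (P x y)%:E = 1).

Fixpoint nstep P n x y : \bar R :=
  if n is n'.+1 then \esum_(w in [set: T]) ((P x w)%:E * nstep P n' w y)
  else (x == y)%:R%:E.

Definition irreducible_chain P := forall x y, exists n, 0 < nstep P n x y.

(* gcd {n >= 1 | P^n(x, x) > 0} = 1 for every x *)
Definition aperiodic_chain P := forall x d,
  (forall n, (0 < n)%N -> 0 < nstep P n x x -> (d %| n)%N) -> d = 1%N.

(* Probability, starting from x, that the first visit to y at a positive time
   takes place at time n.+1. *)
Fixpoint first_visit P n x y : \bar R :=
  if n is n'.+1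
  then \esum_(w in [set w | w != y]) ((P x w)%:E * first_visit P n' w y)
  else (P x y)%:E.

(* The return time to each state is almost surely finite and has finite mean. *)
Definition positive_recurrent P := forall x,
  \sum_(0 <= n <oo) first_visit P n x x = 1 /\
  \sum_(0 <= n <oo) (n.+1%:R%:E * first_visit P n x x) < +oo.

End MarkovChain.

(* The states (i, j) are pairs in nat * 'I_m: level i, phase j. *)
Section GIG1.
Context {R : realType} {m : nat}.
Implicit Types (A B : int -> 'M[R]_m).

Definition gig1_block A B (i k : nat) : 'M[R]_m :=
  if i is 0%N then B k%:Z
  else if k is 0%N then B (- i%:Z)
  else A (k%:Z - i%:Z).

Definition gig1_matrix A B (x y : nat * 'I_m) : R :=
  gig1_block A B x.1 y.1 x.2 y.2.

End GIG1.

Section Matrices.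
Context {R : realType} {m : nat}.
Implicit Types (M : 'M[R]_m).

Definition nonneg_mx M := forall i j, 0 <= M i j.

Definition stochastic_mx M :=
  nonneg_mx M /\ (forall i, \sum_j M i j = 1).

(* For nonnegative M, the incidence digraph of M is strongly connected. *)
Definition irreducible_mx M :=
  forall i j, exists2 n : nat, (0 < n)%N & 0 < (M ^+ n) i j.

(* x is a real eigenvalue whose modulus dominates every complex eigenvalue. *)
Definition is_perron_eigenvalue M (x : R) :=
  eigenvalue M x /\
  (forall mu : R[i], eigenvalue (map_mx (real_complex R) M) mu ->
     `|mu| <= x%:C).

(* Such an x is unique, and exists for every nonnegative M when 0 < m. *)
Definition perron_eigenvalue M : R := xget 0 (is_perron_eigenvalue M).

End Matrices.

(* \sum_(k in Z) u k, where Negz n = - n.+1; meaningful only if both one-sided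
   series converge. *)
Definition bilateral_sum (K : numFieldType) (u : int -> K) : K :=
  limn (series (fun n => u n%:Z : K^o)) +
  limn (series (fun n => u (Negz n) : K^o)).

(* A^*(z) over K, used both for real and for complex z. *)
Definition Astar (K : numFieldType) (m : nat) (A : int -> 'M[K]_m) (z : K) :
    'M[K]_m :=
  \matrix_(r, s) bilateral_sum (fun k => z ^ k * A k r s).

Section RadiusOmegaEta.
Context {R : realType} {m : nat}.
Implicit Types (A : int -> 'M[R]_m).

Definition Asum A : 'M[R]_m :=
  \matrix_(r, s) bilateral_sum (fun k => A k r s).

Definition radius_of_convergence (a : nat -> R) : \bar R :=
  ereal_sup [set x%:E | x in
    [set x : R | 0 <= x /\ cvgn (series (fun n => a n * x ^+ n))]].

Definition phiAplus A : \bar R :=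
  \big[mine/+oo%E]_(r < m) \big[mine/+oo%E]_(s < m)
    radius_of_convergence (fun n => if n is 0%N then 0 else A n%:Z r s).

Definition AstarC A (z : R[i]) : 'M[R[i]]_m :=
  Astar (fun k => map_mx (real_complex R) (A k)) z.

Definition chi A (z : R) : R := perron_eigenvalue (Astar A z).

Definition Omega A : set R[i] :=
  [set z | [/\ 1 < Normc.normc z, ((Normc.normc z)%:E < phiAplus A)%E &
               \det (1%:M - AstarC A z) = 0]].

(* The least-modulus element z_0 of Omega, if it is a positive real; +oo if
   Omega is empty. *)
Definition eta A : \bar R :=
  xget +oo%E [set z0%:E | z0 in
    [set z0 : R | [/\ 0 < z0, Omega A z0%:C &
                      forall z, Omega A z -> z0 <= Normc.normc z]]].

End RadiusOmegaEta.

(* Main.v *)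
(* Call a nonnegative matrix M contractive if M v < v for some v > 0, that is, if
   its spectral radius is below 1. Let b be the vector of mean level increments
   and p the stationary distribution of A. If p b >= 0, then level plus a
   solution of the Poisson equation for b is, after truncation at 0, a
   nonnegative subharmonic function of the chain that vanishes at level 0;
   positive recurrence forces it to vanish everywhere, which is absurd. Hence
   p b < 0 (with b cut off at a finite level, since downward jumps may have
   infinite mean), and perturbing the vector of ones shows that A^*(w) is
   contractive for w slightly above 1. Increasing w, contractivity can only be
   lost at a zero of det(I - A^*(w)), and the first such zero is eta. So A^*(z)
   is contractive, and Perron-Frobenius gives the eigenvector. *)
Require Import Defs.
From mathcomp Require Import all_boot all_order all_algebra.
From mathcomp Require Import all_classical all_reals all_analysis.
From mathcomp Require Import ring lra zify.
Set Implicit Arguments.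
Unset Strict Implicit.
Unset Printing Implicit Defensive.
Import Order.TTheory GRing.Theory Num.Theory.
Import numFieldNormedType.Exports.
Local Open Scope classical_set_scope.
Local Open Scope ring_scope.

(** Contractivity replaces the spectral radius because an explicit vector [v] is checked
    coordinatewise, persists under small changes of the matrix and gives a maximum principle. Perron
    vectors are themselves obtained from it, along the path [t *: M]. Nothing is known about the
    individual blocks [B_k], so the test functions of the chain vanish at level 0: a step from a
    level [K >= 1] is then seen only through the [A_k], with the level cut off at 0. The same
    cut-off [lev K k] serves the perturbation at 1, since
    [(1 + t)^K (1 + t)^k <= (1 + t)^(lev K k)], whose first-order term is a finite mean level. The
    cut-off drifts decrease with [K]. If their [p]-mean never becomes negative, their limits are
    finite. This finiteness bounds the mean one-step decrease of the subharmonic function uniformly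
    over all states; without such a bound, a positive recurrent chain may carry a nonzero
    nonnegative subharmonic function that vanishes at a state. *)

(** * Contractive matrices *)

Section Contractive.
Context {R : realType} {m : nat}.
Implicit Types (M N : 'M[R]_m) (u v x : 'cV[R]_m).

(* For nonnegative [M] this says that the spectral radius is less than 1. *)
Definition contractive M :=
  exists2 v : 'cV[R]_m, (forall i, 0 < v i 0) &
                        (forall i, (M *m v) i 0 < v i 0).

Lemma mulmx_cV_le M u v : nonneg_mx M -> (forall i, u i 0 <= v i 0) ->
  forall i, (M *m u) i 0 <= (M *m v) i 0.
Proof.
by move=> M0 uv i; rewrite !mxE ler_sum// => j _; rewrite ler_wpM2l.
Qed.

(** Maximum principle: where [u i / v i] takes its largest value [c], if [c > 0], then [u <= c v]
    gives [u i <= (M u) i <= c (M v) i < c v i = u i]. *)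
Lemma contractive_le0 M u : nonneg_mx M -> contractive M ->
  (forall i, u i 0 <= (M *m u) i 0) -> forall i, u i 0 <= 0.
Proof.
move=> M0 [v v0 Mv] uM i0; rewrite leNgt; apply/negP => ui0.
pose i := [arg max_(i > i0) (u i 0 / v i 0)]%O.
have imax j : u j 0 / v j 0 <= u i 0 / v i 0.
  by rewrite /i; case: Order.TotalTheory.arg_maxP => // k _; apply.
pose c := u i 0 / v i 0.
have c0 : 0 < c by rewrite (lt_le_trans _ (imax i0))// divr_gt0.
have uc j : u j 0 <= (c *: v) j 0 by rewrite mxE -ler_pdivrMr.
have := le_trans (uM i) (mulmx_cV_le M0 uc i).
rewrite -scalemxAr mxE leNgt (@lt_le_trans _ _ (c * v i 0))//.
  by rewrite ltr_pM2l.
by rewrite divfK// gt_eqF.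
Qed.

Lemma contractive_ge0 M x : nonneg_mx M -> contractive M ->
  (forall i, 0 <= x i 0 - (M *m x) i 0) -> forall i, 0 <= x i 0.
Proof.
move=> M0 cM xM i; have := @contractive_le0 M (- x) M0 cM _ i.
rewrite mxE oppr_le0; apply => {}i.
by rewrite mulmxN !mxE lerN2; have := xM i; rewrite subr_ge0 mxE.
Qed.

(* [s] is the supremum of the points up to which the path stays contractive. If
   [I - N s] were invertible, [v := (I - N s)^-1 1] would be nonnegative as a
   limit case from the left, and hence witness contractivity at [s]. *)
Lemma contractive_singular_path (N : R -> 'M[R]_m) (a b : R) : a <= b ->
  (forall t, a <= t <= b -> nonneg_mx (N t)) ->
  (forall t i j, a <= t <= b -> {for t, continuous (fun t => N t i j)}) ->
  contractive (N a) -> ~ contractive (N b) ->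
  exists s, [/\ a < s <= b, \det (1%:M - N s) = 0 &
                forall t, a <= t < s -> contractive (N t)].
Proof.
move=> ab N0 cN Na Nb.
have cNv (v : 'cV[R]_m) i t : a <= t <= b ->
    {for t, continuous (fun t => (N t *m v) i 0)}.
  move=> tab; rewrite /prop_for /continuous_at mxE.
  under eq_cvg do rewrite mxE.
  apply: cvg_big => [|j _]; first exact: add_continuous.
  apply: cvgM; last exact: cvg_cst.
  exact: cN.
have nearN (v : 'cV[R]_m) t : a <= t <= b ->
    (forall i, (N t *m v) i 0 < v i 0) ->
    \forall t' \near t, forall i, (N t' *m v) i 0 < v i 0.
  move=> tab Nv.
  apply: (filter_forall (nbhs_filter t)) => i.
  exact: (cvgr_lt _ (cNv v i t tab) _ (Nv i)).
have openN t : a <= t <= b -> contractive (N t) ->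
    \forall t' \near t, contractive (N t').
  by move=> tab [v v0 /(nearN _ _ tab)]; apply: filterS => t' h; exists v.
pose E := [set s | a <= s <= b /\ forall t, a <= t <= s -> contractive (N t)].
have Ea : E a.
  by split; [rewrite lexx ab|move=> t; rewrite -eq_le => /eqP <-].
have ubE : ubound E b by move=> s [/andP[]].
have hE : has_sup E by split; [exists a|exists b].
pose s := sup E.
have as_ : a <= s by apply: ub_le_sup => //; exists b.
have sb : s <= b by apply: ge_sup => //; exists a.
have sab : a <= s <= b by rewrite as_.
have ltN t : a <= t < s -> contractive (N t).
  move=> /andP[at_ ts]; have [e [_ eN] te] := sup_gt (ex_intro _ a Ea) ts.
  by apply: eN; rewrite at_ ltW.
have nNs : ~ contractive (N s).
  move=> Ns; have sltb : s < b.
    by rewrite lt_neqAle sb andbT; apply/eqP => sb'; rewrite sb' in Ns.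
  have [/= e e0 He] := openN _ sab Ns.
  pose d := Num.min (e / 2) (b - s).
  have d0 : 0 < d by rewrite lt_min divr_gt0//= subr_gt0.
  have : E (s + d).
    have sdb : s + d <= b by rewrite -lerBrDl ge_min lexx orbT.
    split; first by rewrite sdb andbT (le_trans as_)// lerDl ltW.
    move=> t /andP[at_ tsd]; have [ts|st] := ltP t s.
      by apply: ltN; rewrite at_.
    apply: He; rewrite /= distrC ger0_norm ?subr_ge0//.
    rewrite ltrBlDl (le_lt_trans tsd)// ltrD2l.
    have := ge_min (e / 2) (e / 2) (b - s); rewrite lexx /= => h.
    by rewrite (le_lt_trans h)// ltr_pdivrMr// ltr_pMr// ltr1n.
  have := ub_le_sup (ex_intro _ b ubE) => /[apply].
  by rewrite -/s gerDl leNgt d0.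
have ltas : a < s.
  by rewrite lt_neqAle as_ andbT; apply/eqP => as'; apply: nNs; rewrite -as'.
exists s; split => //; first by rewrite ltas.
apply/eqP/negPn/negP => dN0.
have uN : 1%:M - N s \in unitmx by rewrite unitmxE unitfE.
have [v vE] : exists v : 'cV[R]_m, v - N s *m v = const_mx 1.
  exists (invmx (1%:M - N s) *m const_mx 1).
  by rewrite -{1}(mul1mx (_ *m const_mx 1)) -mulmxBl mulKVmx.
have vi i : v i 0 = 1 + (N s *m v) i 0.
  by have /matrixP/(_ i 0) := vE; rewrite !mxE => <-; rewrite subrK.
(* [N s v < v] is an open condition, so it survives at some [t < s], where contractivity is already
   known and forces [v >= 0]. *)
have [t [ats vt]] : exists t, a <= t < s /\ forall i, (N t *m v) i 0 < v i 0.
  have [|/= e e0 He] := nearN v s sab; first by move=> i; rewrite vi ltrDr.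
  pose d := Num.min (e / 2) (s - a).
  have d0 : 0 < d by rewrite lt_min divr_gt0//= subr_gt0.
  exists (s - d); split.
    by rewrite gtrBl d0 andbT lerBrDl -lerBrDr ge_min lexx orbT.
  apply: He => /=; rewrite opprB addrCA subrr addr0 gtr0_norm//.
  have := ge_min (e / 2) (e / 2) (s - a); rewrite lexx /= => h.
  by rewrite (le_lt_trans h)// ltr_pdivrMr// ltr_pMr// ltr1n.
have tab : a <= t <= b.
  by move/andP: ats => [-> ts] /=; rewrite (le_trans (ltW ts)).
have v0 : forall i, 0 <= v i 0.
  apply: (contractive_ge0 (N0 _ tab) (ltN _ ats)) => i.
  by rewrite subr_ge0 ltW.
apply: nNs; exists v => i; last by rewrite vi ltrDr.
rewrite vi ltr_pwDl// !mxE sumr_ge0// => j _.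
by rewrite mulr_ge0// N0.
Qed.

End Contractive.

(** * Perron-Frobenius *)

Section Perron.
Context {R : realType} {m : nat}.
Implicit Types (M N : 'M[R]_m) (u v x : 'cV[R]_m).

Lemma nonneg_mx_exp M n : nonneg_mx M -> nonneg_mx (M ^+ n).
Proof.
move=> M0; elim: n => [|n IHn] i j; first by rewrite expr0 !mxE ler0n.
by rewrite exprS mxE sumr_ge0// => k _; rewrite mulr_ge0.
Qed.

Lemma mulmx_cV_ge M x i j : nonneg_mx M -> (forall i, 0 <= x i 0) ->
  M i j * x j 0 <= (M *m x) i 0.
Proof.
move=> M0 x0; rewrite mxE (bigD1 j)//= lerDl sumr_ge0// => k _.
by rewrite mulr_ge0.
Qed.

(** [x = s^n M^n x] for every [n], and some power links [i] to a coordinate where [x] is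
    positive. *)
Lemma irreducible_fixed_gt0 M x s : nonneg_mx M -> irreducible_mx M ->
  0 < s -> (forall i, 0 <= x i 0) -> x != 0 -> s *: (M *m x) = x ->
  forall i, 0 < x i 0.
Proof.
move=> M0 Mirr s0 x0 xN0 sMx i.
have [j xj] : exists j, 0 < x j 0.
  apply/existsP; apply: contraR xN0; rewrite negb_exists => /forallP xle0.
  apply/eqP/matrixP => k l; rewrite ord1 mxE; apply/eqP; rewrite eq_le x0 andbT.
  by rewrite leNgt.
have sMnx n : s ^+ n *: (M ^+ n *m x) = x.
  elim: n => [|n IHn]; first by rewrite !expr0 scale1r mul1mx.
  by rewrite !exprSr -scalerA -mulmxA scalemxAr sMx.
have [n _ Mn] := Mirr i j.
rewrite -(sMnx n) mxE mulr_gt0// ?exprn_gt0//.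
rewrite (lt_le_trans _ (mulmx_cV_ge i j (nonneg_mx_exp n M0) x0))//.
by rewrite mulr_gt0.
Qed.

Lemma irreducible_mx_support M N :
  nonneg_mx M -> nonneg_mx N -> (forall r s, 0 < M r s -> 0 < N r s) ->
  irreducible_mx M -> irreducible_mx N.
Proof.
move=> M0 N0 MN Mirr i j; have [n n0 Mn] := Mirr i j; exists n => //.
elim: n i {n0} Mn => [|n IHn] i; first by rewrite !expr0.
rewrite !exprS => Mn.
have [k Mk] : exists k, 0 < M i k * (M ^+ n) k j.
  apply/existsP; apply: contraLR Mn; rewrite negb_exists => /forallP Mk.
  by rewrite -leNgt mxE sumr_le0// => k _; rewrite leNgt.
have Mn0 := nonneg_mx_exp n M0 k j.
have Mik : 0 < M i k.
  by rewrite lt_neqAle M0 andbT; apply: contraTneq Mk => <-; rewrite mul0r ltxx.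
rewrite pmulr_rgt0// in Mk.
rewrite mxE (bigD1 k)//= ltr_pwDl//; first by rewrite mulr_gt0 ?MN ?IHn.
by rewrite sumr_ge0// => l _; rewrite mulr_ge0 ?N0//; exact: nonneg_mx_exp.
Qed.

(** Periodicity may keep every single power from being positive, hence a sum over all exponents up
    to the largest one needed. *)
Lemma irreducible_sum_gt0 M : nonneg_mx M -> irreducible_mx M ->
  exists L, forall i j, 0 < (\sum_(k < L) M ^+ k) i j.
Proof.
move=> M0 Mirr.
have /fin_all_exists[f fP] : forall ij : 'I_m * 'I_m,
    exists n, 0 < (M ^+ n) ij.1 ij.2.
  by move=> [i j]; have [n _ ?] := Mirr i j; exists n.
exists (\max_ij f ij).+1 => i j.
have fL : (f (i, j) < (\max_ij f ij).+1)%N by rewrite ltnS leq_bigmax.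
rewrite summxE (bigD1 (Ordinal fL))//= ltr_pwDl//.
by rewrite sumr_ge0// => k _; exact: nonneg_mx_exp.
Qed.

Lemma contractive_exp_le M v n : nonneg_mx M -> (forall i, 0 <= v i 0) ->
  (forall i, (M *m v) i 0 <= v i 0) -> forall i, (M ^+ n *m v) i 0 <= v i 0.
Proof.
move=> M0 v0 Mv; elim: n => [|n IHn] i; first by rewrite expr0 mul1mx.
rewrite exprSr -mulmxA (le_trans _ (IHn i))//.
by apply: mulmx_cV_le => //; exact: nonneg_mx_exp.
Qed.

(* Along the path [t *: M], contractivity is first lost at [1 / rho]. *)
Lemma perron_frobenius M : (0 < m)%N -> nonneg_mx M -> irreducible_mx M ->
  exists rho (y : 'cV[R]_m),
    [/\ 0 < rho, forall i, 0 < y i 0 & M *m y = rho *: y].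
Proof.
move=> m0 M0 Mirr; pose i0 := Ordinal m0.
have [n n0 Mn] := Mirr i0 i0.
(* [b] is chosen so that [b^n c > 1]: then [(b M)^n] has a diagonal entry above 1, which excludes
   contractivity of [b M]. *)
pose c := (M ^+ n) i0 i0; pose b := 1 + c^-1.
have b1 : 1 <= b by rewrite lerDl invr_ge0 ltW.
have b0 : 0 <= b by rewrite (le_trans ler01).
have nM t : 0 <= t <= b -> nonneg_mx (t *: M).
  by move=> /andP[t0 _] i j; rewrite mxE mulr_ge0.
have [|||s [/andP[s0 sb] ds cs]] :=
  @contractive_singular_path R m (fun t => t *: M) 0 b b0 nM.
- move=> t i j _; rewrite /prop_for /continuous_at mxE.
  by under eq_cvg do rewrite mxE; apply: cvgM; [exact: cvg_id|exact: cvg_cst].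
- by exists (const_mx 1) => i; rewrite ?scale0r ?mul0mx !mxE ltr01.
- move=> [v v0 bv].
  have v0' i : 0 <= v i 0 by exact: ltW.
  have := @contractive_exp_le (b *: M) v n _ v0' (fun i => ltW (bv i)) i0.
  have -> : (b *: M) ^+ n = b ^+ n *: M ^+ n.
    elim: (n) => [|k IHk]; first by rewrite !expr0 scale1r.
    by rewrite !exprS IHk -[LHS]scalemxAl -scalemxAr scalerA.
  have bM : nonneg_mx (b *: M) by apply: nM; rewrite b0 lexx.
  move=> /(_ bM); rewrite leNgt -scalemxAl mxE => /negP; apply.
  apply: (@lt_le_trans _ _ (b ^+ n * (c * v i0 0))); last first.
    rewrite ler_wpM2l// ?exprn_ge0//; apply: mulmx_cV_ge => //.
    exact: nonneg_mx_exp.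
  rewrite mulrA ltr_pMl//; apply: (@lt_le_trans _ _ (b * c)).
    by rewrite mulrDl mul1r mulVf ?gt_eqF// ltrDr.
  by apply: ler_wpM2r; [exact: ltW|exact: ler_eXnr].
have : \det (1%:M - s *: M)^T == 0 by rewrite det_tr ds.
move=> /det0P[w wN0 wM].
pose u : 'cV[R]_m := w^T.
have uE : u = s *: (M *m u).
  apply/eqP; rewrite -subr_eq0; apply/eqP/trmx_inj.
  by rewrite trmx0 -wM /u -[w in RHS]trmxK -trmx_mul mulmxBl mul1mx scalemxAl.
pose x : 'cV[R]_m := map_mx Num.norm u.
have x0 i : 0 <= x i 0 by rewrite mxE.
have xN0 : x != 0.
  apply: contraNneq wN0 => x0'; apply/eqP/matrixP => i j; rewrite ord1 mxE.
  move/matrixP/(_ j 0) : x0'; rewrite !mxE => /eqP.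
  by rewrite normr_eq0 => /eqP.
have sx i : x i 0 <= s * (M *m x) i 0.
  rewrite mxE {1}uE mxE normrM gtr0_norm// ler_pM2l// !mxE.
  apply: le_trans (ler_norm_sum _ _ _) _; apply: ler_sum => j _.
  by rewrite !mxE normrM ger0_norm.
(* If [x <= s M x] were strict somewhere, applying the positive matrix [S], which commutes with [M],
   would make it strict everywhere: [z < s M z]. Then [z <= t M z] for some [t < s], against
   contractivity of [t M]. *)
have sMx : s *: (M *m x) = x.
  apply/eqP; rewrite -subr_eq0; apply: contraT => dN0.
  set d := _ - _ in dN0.
  have d0 i : 0 <= d i 0.
    by have := sx i; rewrite /d -subr_ge0 !mxE.
  have [L SL] := irreducible_sum_gt0 M0 Mirr.
  set S := \sum_(k < L) M ^+ k in SL.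
  have S0 : nonneg_mx S by move=> i j; exact: ltW.
  have [j dj] : exists j, 0 < d j 0.
    apply/existsP; apply: contraR dN0; rewrite negb_exists => /forallP dle0.
    apply/eqP/matrixP => k l; rewrite ord1 [RHS]mxE; apply/eqP.
    by rewrite eq_le d0 andbT leNgt.
  have MS : M *m S = S *m M.
    rewrite mulmx_sumr mulmx_suml; apply: eq_bigr => k _.
    by rewrite -[LHS]exprS -[RHS]exprSr.
  have Sd i : 0 < (S *m d) i 0.
    rewrite (lt_le_trans _ (mulmx_cV_ge i j S0 d0))//.
    by rewrite mulr_gt0.
  pose z := S *m x.
  have z0 i : 0 <= z i 0.
    by rewrite mxE sumr_ge0// => k _; rewrite mulr_ge0.
  have sz i : z i 0 < s * (M *m z) i 0.
    rewrite -subr_gt0 (_ : _ - _ = (S *m d) i 0)//.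
    by rewrite /d mulmxBr -scalemxAr /z !mulmxA MS !mxE.
  have Mz i : 0 < (M *m z) i 0.
    by have := le_lt_trans (z0 i) (sz i); rewrite pmulr_rgt0.
  pose k := [arg max_(i > i0) (z i 0 / (M *m z) i 0)]%O.
  have kmax i : z i 0 / (M *m z) i 0 <= z k 0 / (M *m z) k 0.
    by rewrite /k; case: Order.TotalTheory.arg_maxP => // l _; apply.
  pose t := z k 0 / (M *m z) k 0.
  have t0 : 0 <= t by rewrite divr_ge0// ltW.
  have ts : t < s by rewrite ltr_pdivrMr.
  have tsb : 0 <= t <= b by rewrite t0 (le_trans (ltW ts)).
  have zle0 := @contractive_le0 R m (t *: M) z (nM t tsb) (cs t _).
  have {zle0}zle0 : forall i, z i 0 <= 0.
    apply: zle0; first by rewrite t0.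
    by move=> i; rewrite -scalemxAl [leRHS]mxE -ler_pdivrMr.
  have : 0 < (M *m z) i0 0 by [].
  by rewrite ltNge => /negP[]; rewrite mxE sumr_le0// => l _; rewrite mulr_ge0_le0.
exists s^-1, x; split; first by rewrite invr_gt0.
  exact: irreducible_fixed_gt0 sMx.
by rewrite -{2}sMx scalerA mulVf ?scale1r// gt_eqF.
Qed.

End Perron.

(** * Domination of complex matrices and identification of the Perron eigenvalue *)

Section ComplexBounds.
Context {R : realType} {m : nat}.
Local Open Scope complex_scope.
Import Normc.
Implicit Types (M N : 'M[R]_m) (Z : 'M[R[i]]_m).

Lemma normc_ge0 (z : R[i]) : 0 <= normc z.
Proof. by case: z => a b; exact: sqrtr_ge0. Qed.

Lemma normc_sum n (u : 'I_n -> R[i]) :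
  normc (\sum_i u i) <= \sum_i normc (u i).
Proof.
elim: n u => [|n IHn] u; first by rewrite !big_ord0 normc0.
by rewrite !big_ord_recl (le_trans (le_normcD _ _))// lerD2l.
Qed.

Lemma normc_real (a : R) : 0 <= a -> normc a%:C = a.
Proof. by move=> a0; rewrite /= expr0n /= addr0 sqrtr_sqr ger0_norm. Qed.

Lemma normcE_norm (z : R[i]) : `|z| = (normc z)%:C.
Proof. by []. Qed.

(** If [u = Z u], the moduli satisfy [|u| <= N |u|], so the maximum principle gives [u = 0]. *)
Lemma contractive_det_neq0 N Z : nonneg_mx N -> contractive N ->
  (forall i j, normc (Z i j) <= N i j) -> \det (1%:M - Z) != 0.
Proof.
move=> N0 cN ZN; apply/eqP => dZ.
have : \det (1%:M - Z)^T == 0 by rewrite det_tr dZ.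
move=> /det0P[w wN0 wM].
pose u : 'cV[R[i]]_m := w^T.
have uE : u = Z *m u.
  apply/eqP; rewrite -subr_eq0; apply/eqP/trmx_inj.
  by rewrite trmx0 -wM /u -[w in RHS]trmxK -trmx_mul mulmxBl mul1mx.
pose x : 'cV[R]_m := \col_i normc (u i 0).
have xN i : x i 0 <= (N *m x) i 0.
  rewrite {1}/x [leLHS]mxE uE !mxE; apply: le_trans (normc_sum _) _.
  apply: ler_sum => j _; rewrite normcM [x j 0]mxE.
  by rewrite ler_wpM2r// normc_ge0.
have xle0 := contractive_le0 N0 cN xN.
case/eqP: wN0; apply/matrixP => i j; rewrite ord1 [RHS]mxE.
apply: eq0_normc; apply/eqP; rewrite eq_le normc_ge0 andbT.
by have := xle0 j; rewrite !mxE.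
Qed.

(** Pairing the moduli of a left eigenvector for [mu] with the positive right eigenvector [y] gives
    [|mu| <= rho]. Two dominant real eigenvalues dominate each other, which settles the choice made
    by [xget]. *)
Lemma perron_eigenvalue_positive M rho (y : 'cV[R]_m) : (0 < m)%N ->
  nonneg_mx M -> 0 < rho -> (forall i, 0 < y i 0) -> M *m y = rho *: y ->
  perron_eigenvalue M = rho.
Proof.
move=> m0 M0 rho0 y0 My; pose i0 := Ordinal m0.
have Prho : is_perron_eigenvalue M rho.
  split.
    (* [eigenvalue] refers to row vectors and [y] is a column; the determinant of the transpose
       bridges the two. *)
    have : \det (rho%:M - M)^T == 0.
      rewrite det_tr -det_tr; apply/det0P; exists y^T.
        apply: contraTneq (y0 i0) => /matrixP/(_ 0 i0).
        by rewrite !mxE => ->; rewrite ltxx.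
      by rewrite -trmx_mul mulmxBl My mul_scalar_mx subrr trmx0.
    rewrite det_tr => /det0P[w wN0 wM]; apply/eigenvalueP; exists w => //.
    by apply/eqP; rewrite eq_sym -subr_eq0 -mul_mx_scalar -mulmxBr wM.
  move=> mu /eigenvalueP[v vM vN0].
  rewrite normcE_norm lecR.
  have [j vj] : exists j, v 0 j != 0.
    apply/existsP; apply: contraR vN0; rewrite negb_exists => /forallP v0.
    by apply/eqP/matrixP => k l; rewrite ord1 mxE; apply/eqP; have := v0 l; rewrite negbK.
  have nvj : 0 < normc (v 0 j).
    rewrite lt_neqAle normc_ge0 andbT eq_sym; apply: contra vj => /eqP.
    by move=> /eq0_normc ->.
  have S0 : 0 < \sum_j normc (v 0 j) * y j 0.
    rewrite (bigD1 j)//= ltr_pwDl ?mulr_gt0// sumr_ge0// => k _.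
    by rewrite mulr_ge0 ?normc_ge0// ltW.
  rewrite -(ler_pM2r S0) !mulr_sumr.
  have le1 k : normc mu * normc (v 0 k) <= \sum_i normc (v 0 i) * M i k.
    rewrite -normcM; have /matrixP/(_ 0 k) := vM.
    rewrite [in RHS]mxE => <-; rewrite mxE.
    apply: le_trans (normc_sum _) _; apply: ler_sum => i _.
    by rewrite normcM mxE normc_real.
  apply: (@le_trans _ _ (\sum_k (\sum_i normc (v 0 i) * M i k) * y k 0)).
    by apply: ler_sum => k _; rewrite mulrA ler_wpM2r// ltW.
  under eq_bigr do rewrite mulr_suml.
  rewrite exchange_big/=; apply: ler_sum => i _.
  under eq_bigr do rewrite -mulrA.
  rewrite -mulr_sumr mulrCA ler_wpM2l ?normc_ge0//.
  by have /matrixP/(_ i 0) := My; rewrite !mxE => ->.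
apply: xget_unique => // s [es ds].
have rho_ge0 := ltW rho0.
have := ds rho%:C; rewrite normcE_norm normc_real// lecR.
have eC t : eigenvalue M t -> eigenvalue (map_mx (real_complex R) M) t%:C.
  move=> /eigenvalueP[w wM wN0]; apply/eigenvalueP.
  exists (map_mx (real_complex R) w); last by rewrite map_mx_eq0.
  by rewrite -map_mxM wM map_mxZ.
move=> /(_ (eC _ Prho.1)) rs.
have := Prho.2 s%:C (eC _ es).
rewrite normcE_norm normc_real ?(le_trans rho_ge0)// lecR => sr.
by apply/eqP; rewrite eq_le sr.
Qed.

Lemma contractive_perron M : (0 < m)%N -> nonneg_mx M -> irreducible_mx M ->
  contractive M -> perron_eigenvalue M < 1 /\
  exists Y : 'cV[R]_m,
    (forall j, 1 <= Y j 0) /\ M *m Y = perron_eigenvalue M *: Y.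
Proof.
move=> m0 M0 Mirr cM; pose i0 := Ordinal m0.
have [rho [y [rho0 y0 My]]] := perron_frobenius m0 M0 Mirr.
rewrite (perron_eigenvalue_positive m0 M0 rho0 y0 My); split.
  rewrite ltNge; apply/negP => rho1.
  have yM i : y i 0 <= (M *m y) i 0.
    by rewrite My mxE ler_peMl// ltW.
  by have := contractive_le0 M0 cM yM i0; rewrite leNgt y0.
(* Scaling by the sum of the inverses makes each entry at least [(y j)^-1 * y j = 1]. *)
pose c := \sum_j (y j 0)^-1.
have c0 j : 0 <= (y j 0)^-1 by rewrite invr_ge0 ltW.
exists (c *: y); split; last by rewrite -scalemxAr My !scalerA mulrC.
move=> j; rewrite mxE -ler_pdivrMr// mul1r /c (bigD1 j)//= lerDl.
by rewrite sumr_ge0.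
Qed.

End ComplexBounds.

(** * Stationary distribution and Poisson equation *)

Section Poisson.
Context {R : realType} {m : nat}.
Variable A : 'M[R]_m.
Hypotheses (m0 : (0 < m)%N) (Airr : irreducible_mx A) (Ast : stochastic_mx A).

Lemma irreducible_mx_tr : irreducible_mx A^T.
Proof.
have AT n : A^T ^+ n = (A ^+ n)^T.
  elim: n => [|n IHn]; first by rewrite !expr0 trmx1.
  by rewrite exprSr exprS IHn; exact: esym (trmx_mul _ _).
by move=> i j; have [n n0 An] := Airr j i; exists n => //; rewrite AT mxE.
Qed.

Lemma nonneg_mx_tr : nonneg_mx A^T.
Proof. by move=> i j; rewrite mxE; exact: Ast.1. Qed.

Lemma stochastic_mul1 : A *m const_mx 1 = const_mx 1 :> 'cV[R]_m.
Proof.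
apply/matrixP => i j; rewrite !mxE -[RHS](Ast.2 i).
by apply: eq_bigr => k _; rewrite mxE mulr1.
Qed.

(** This is the normalised Perron vector of [A^T]; pairing it with the vector of ones, which [A]
    fixes, shows that its eigenvalue is 1. *)
Lemma stationary_distribution : exists p : 'cV[R]_m,
  [/\ forall i, 0 < p i 0, \sum_i p i 0 = 1 & A^T *m p = p].
Proof.
have [rho [y [rho0 y0 Ay]]] := perron_frobenius m0 nonneg_mx_tr irreducible_mx_tr.
pose S := \sum_i y i 0.
have S0 : 0 < S.
  by rewrite /S (bigD1 (Ordinal m0))//= ltr_pwDl// sumr_ge0// => k _; exact: ltW.
have rho1 : rho = 1.
  have : (const_mx 1 : 'rV_m) *m (A^T *m y) = const_mx 1 *m y.
    rewrite mulmxA; congr (_ *m _); apply: trmx_inj.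
    by rewrite trmx_mul trmxK !trmx_const stochastic_mul1.
  rewrite Ay -scalemxAr => /matrixP/(_ 0 0); rewrite mxE.
  have -> : ((const_mx 1 : 'rV_m) *m y) 0 0 = S.
    by rewrite mxE; apply: eq_bigr => i _; rewrite mxE mul1r.
  by move=> h; apply: (mulIf (lt0r_neq0 S0)); rewrite h mul1r.
exists (S^-1 *: y); split.
- by move=> i; rewrite mxE mulr_gt0// invr_gt0.
- by under eq_bigr do rewrite mxE; rewrite -mulr_sumr mulVf// gt_eqF.
- by rewrite -scalemxAr Ay rho1 scale1r.
Qed.

(** Subtracting from [c] the least ratio times [p] leaves a nonnegative fixed vector with a zero
    entry, while a nonzero one would be positive everywhere. *)
Lemma stationary_unique (p c : 'cV[R]_m) : (forall i, 0 < p i 0) ->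
  A^T *m p = p -> A^T *m c = c -> exists k, c = k *: p.
Proof.
move=> p0 Ap Ac.
pose i := [arg min_(i < Ordinal m0) (c i 0 / p i 0)]%O.
have imin j : c i 0 / p i 0 <= c j 0 / p j 0.
  by rewrite /i; case: Order.TotalTheory.arg_minP => // k _; apply.
exists (c i 0 / p i 0); apply/eqP; rewrite -subr_eq0; apply: contraT => zN0.
set z := _ - _ in zN0.
have z0 j : 0 <= z j 0 by rewrite !mxE subr_ge0 -ler_pdivlMr.
have Az : 1 *: (A^T *m z) = z by rewrite scale1r mulmxBr -scalemxAr Ap Ac.
have := irreducible_fixed_gt0 nonneg_mx_tr irreducible_mx_tr ltr01 z0 zN0 Az i.
by rewrite !mxE divfK ?gt_eqF// subrr ltxx.
Qed.

(** Fredholm alternative: [p] spans the kernel of [(I - A)^T], and [b - d 1] is orthogonal to [p],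
    hence lies in the range of [I - A]. *)
Lemma poisson_equation (p b : 'cV[R]_m) : (forall i, 0 < p i 0) ->
  \sum_i p i 0 = 1 -> A^T *m p = p ->
  exists h : 'cV[R]_m,
    forall i, b i 0 + (A *m h) i 0 - h i 0 = \sum_j p j 0 * b j 0.
Proof.
move=> p0 p1 Ap; set d := \sum_j _.
pose N := (1%:M - A)^T; pose c : 'cV[R]_m := b - const_mx d.
have : (c^T <= N)%MS.
  rewrite submxE; apply/eqP/trmx_inj; rewrite trmx_mul trmxK trmx0.
  apply/row_matrixP => j; rewrite row_mul row0.
  pose q := col j (cokermx N).
  have Nq : N *m q = 0 by rewrite /q colE mulmxA mulmx_coker mul0mx.
  have [k qk] : exists k, q = k *: p.
    apply: (stationary_unique p0 Ap).
    move/eqP: Nq; rewrite /N linearB/= trmx1 mulmxBl mul1mx subr_eq0.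
    by move=> /eqP.
  rewrite -tr_col -/q qk linearZ/= -scalemxAl.
  suff -> : p^T *m c = 0 by rewrite scaler0.
  apply/matrixP => i l; rewrite !ord1 !mxE.
  under eq_bigr do rewrite !mxE mulrBr.
  by rewrite sumrB -mulr_suml p1 mul1r subrr.
move=> /submxP[g gN]; exists g^T => i.
have -> : b = const_mx d + (g^T - A *m g^T).
  have -> : g^T - A *m g^T = c.
    by rewrite -[c]trmxK gN trmx_mul /N trmxK mulmxBl mul1mx.
  by rewrite addrC subrK.
by rewrite !mxE; ring.
Qed.

End Poisson.

(** * Bilateral sums and power series *)

Section BilateralSum.
Context {R : realType}.
Implicit Types (u v : int -> R) (l : R).

(** Convergence of both halves is built in, since [limn] of a divergent series is only a default
    value. *)
Definition is_bsum u l := exists lp ln : R,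
  [/\ series (fun n => u n%:Z) @ \oo --> lp,
      series (fun n => u (Negz n)) @ \oo --> ln & l = lp + ln].

Lemma is_bsum_bilateral u l : is_bsum u l -> bilateral_sum u = l.
Proof.
move=> [lp [ln [up un ->]]]; rewrite /bilateral_sum.
congr (_ + _); exact: cvg_lim.
Qed.

Lemma is_bsum_eq u v l : u =1 v -> is_bsum u l -> is_bsum v l.
Proof. by move=> /funext ->. Qed.

Lemma is_bsum0 : is_bsum (fun=> 0) 0.
Proof.
have s0 : series (fun=> 0 : R) = cst 0.
  by apply/funext => n; rewrite /series/= big1.
by exists 0, 0; split; rewrite ?addr0// s0; exact: cvg_cst.
Qed.

Lemma is_bsumD u v l l' : is_bsum u l -> is_bsum v l' ->
  is_bsum (fun k => u k + v k) (l + l').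
Proof.
move=> [lp [ln [up un ->]]] [lp' [ln' [vp vn ->]]].
exists (lp + lp'), (ln + ln'); split; last by rewrite addrACA.
- rewrite (_ : series _ = series (fun n => u n%:Z) + series (fun n => v n%:Z)).
    exact: cvgD.
  by rewrite -seriesD.
- rewrite (_ : series _ = series (fun n => u (Negz n)) +
    series (fun n => v (Negz n))); first exact: cvgD.
  by rewrite -seriesD.
Qed.

Lemma cvg_seriesZ (u : nat -> R) l a : series u @ \oo --> l ->
  series (fun n => a * u n) @ \oo --> a * l.
Proof.
move=> ul; rewrite (_ : series _ = (fun n => a * series u n)).
  by apply: cvgM => //; exact: cvg_cst.
by apply/funext => n; rewrite /series/= mulr_sumr.
Qed.

Lemma is_bsumZ u l (a : R) : is_bsum u l -> is_bsum (fun k => a * u k) (a * l).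
Proof.
move=> [lp [ln [up un ->]]].
exists (a * lp), (a * ln); split; last by rewrite mulrDr.
- exact: cvg_seriesZ.
- exact: cvg_seriesZ.
Qed.

Lemma cvg_series_le (u v : nat -> R) (l l' : R) : (forall n, u n <= v n) ->
  series u @ \oo --> l -> series v @ \oo --> l' -> l <= l'.
Proof.
move=> uv ul vl'; have uc := cvgP _ ul; have vc := cvgP _ vl'.
rewrite -(cvg_lim _ ul)// -(cvg_lim _ vl')//.
exact: lim_series_le.
Qed.

Lemma is_bsum_le u v l l' : (forall k, u k <= v k) ->
  is_bsum u l -> is_bsum v l' -> l <= l'.
Proof.
move=> uv [lp [ln [up un ->]]] [lp' [ln' [vp vn ->]]].
apply: lerD; [exact: (cvg_series_le _ up vp)|exact: (cvg_series_le _ un vn)].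
Qed.

Lemma is_bsum_ge0 u l : (forall k, 0 <= u k) -> is_bsum u l -> 0 <= l.
Proof. by move=> u0; exact: (is_bsum_le u0 is_bsum0). Qed.

Lemma is_bsum_dom u v l : (forall k, 0 <= u k <= v k) -> is_bsum v l ->
  exists l', is_bsum u l'.
Proof.
move=> uv [lp [ln [vp vn _]]].
have u0 k : 0 <= u k by have /andP[] := uv k.
have ulev k : u k <= v k by have /andP[] := uv k.
have v0 k : 0 <= v k := le_trans (u0 k) (ulev k).
have cp : cvgn (series (fun n => u n%:Z)).
  by apply: (@series_le_cvg _ _ (fun n => v n%:Z)) => //; exact: cvgP vp.
have cn : cvgn (series (fun n => u (Negz n))).
  by apply: (@series_le_cvg _ _ (fun n => v (Negz n))) => //; exact: cvgP vn.
by exists (limn (series (fun n => u n%:Z)) + limn (series (fun n => u (Negz n)))),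
  (limn (series (fun n => u n%:Z))), (limn (series (fun n => u (Negz n)))).
Qed.

Lemma is_bsum_term_le u l k :
  (forall k, 0 <= u k) -> is_bsum u l -> u k <= l.
Proof.
move=> u0 [lp [ln [up un ->]]].
have term_le (v : nat -> R) lv n : (forall n, 0 <= v n) ->
    series v @ \oo --> lv -> 0 <= lv /\ v n <= lv.
  move=> v0 vl.
  have nd : nondecreasing_seq (series v).
    by apply/nondecreasing_seqP => i; rewrite /series/= big_nat_recr//= lerDl.
  have vle i : series v i <= lv.
    by rewrite -(cvg_lim _ vl)//; apply: nondecreasing_cvgn_le => //; exact: cvgP vl.
  split; first by have := vle 0%N; rewrite /series/= big_geq.
  apply: le_trans (vle n.+1); rewrite /series/= big_nat_recr//= lerDr.
  by rewrite sumr_ge0.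
case: k => n.
  have [_ h] := term_le _ _ n (fun n => u0 n%:Z) up.
  have [h' _] := term_le _ _ n (fun n => u0 (Negz n)) un.
  by rewrite (le_trans h)// lerDl.
have [h _] := term_le _ _ n (fun n => u0 n%:Z) up.
have [_ h'] := term_le _ _ n (fun n => u0 (Negz n)) un.
by rewrite (le_trans h')// lerDr.
Qed.

Lemma is_bsum_pred u l : is_bsum u l -> is_bsum (fun k => u (k - 1)) l.
Proof.
move=> [lp [ln [up un ->]]].
exists (u (Negz 0) + lp), (ln - u (Negz 0)); split.
- rewrite -(cvg_shiftS (series _)).
  rewrite (_ : (fun n => _) = (fun n => u (Negz 0) + series (fun n => u n%:Z) n)).
    by apply: cvgD => //; exact: cvg_cst.
  apply/funext => n; rewrite /series/= big_nat_recl//; congr (_ + _).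
  by apply: eq_bigr => i _; rewrite -addn1 PoszD addrK.
- rewrite (_ : series _ = (fun n => series (fun n => u (Negz n)) n.+1 - u (Negz 0))).
    apply: cvgB; last exact: cvg_cst.
    by rewrite (cvg_shiftS (series _)).
  apply/funext => n; rewrite /series/= big_nat_recl// addrC addKr.
  by apply: eq_bigr => i _; congr u; lia.
- by ring.
Qed.

(** The shift brings the whole support into the nonnegative integers; the new index is the level
    reached from level [i]. *)
Lemma is_bsum_shift u l (i : nat) : (forall k, k < - i%:Z -> u k = 0) ->
  is_bsum u l -> series (fun k : nat => u (k%:Z - i%:Z)) @ \oo --> l.
Proof.
move=> ui ul.
have : is_bsum (fun k => u (k - i%:Z)) l.
  elim: i {ui} => [|i IHi]; first by apply: is_bsum_eq ul => k; rewrite subr0.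
  apply: is_bsum_eq (is_bsum_pred IHi) => k.
  by congr u; lia.
move=> [lp [ln [up un ->]]].
suff -> : ln = 0 by rewrite addr0.
rewrite -(cvg_lim _ un)//.
have -> : series (fun n => u (Negz n - i%:Z)) = cst 0.
  by apply/funext => n; rewrite /series/= big1// => k _; apply: ui; lia.
exact: lim_cst.
Qed.

End BilateralSum.

(** * Power series with nonnegative coefficients *)

Section PowerSeries.
Context {R : realType}.
Implicit Types (a : nat -> R).

(** Chord slopes of the convex function [x^n] increase from [[x, y]] to [[y, Z]]; denominators are
    cleared so that the points may coincide. *)
Lemma subX_convex (x y Z : R) n : 0 <= x -> x <= y -> y <= Z ->
  (y ^+ n - x ^+ n) * (Z - y) <= (y - x) * (Z ^+ n - y ^+ n).
Proof.
move=> x0 xy yZ; have y0 := le_trans x0 xy.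
elim: n => [|n IHn]; first by rewrite !expr0 !subrr mul0r mulr0.
have -> : y ^+ n.+1 - x ^+ n.+1 = y * (y ^+ n - x ^+ n) + (y - x) * x ^+ n.
  by rewrite !exprS; ring.
have -> : Z ^+ n.+1 - y ^+ n.+1 = y * (Z ^+ n - y ^+ n) + (Z - y) * Z ^+ n.
  by rewrite !exprS; ring.
rewrite [leLHS]mulrDl [leRHS]mulrDr lerD//.
  by rewrite -mulrA [leRHS]mulrCA ler_wpM2l.
rewrite [leRHS]mulrCA mulrC ler_wpM2l ?subr_ge0//.
rewrite ler_wpM2l ?subr_ge0//; apply: lerXn2r; rewrite ?nnegrE//.
  exact: le_trans yZ.
exact: le_trans yZ.
Qed.

Definition psum a (x : R) : R := limn (series (fun n => a n * x ^+ n)).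

Lemma psum_cvg_le a x Z : (forall n, 0 <= a n) -> 0 <= x <= Z ->
  cvgn (series (fun n => a n * Z ^+ n)) ->
  cvgn (series (fun n => a n * x ^+ n)).
Proof.
move=> a0 /andP[x0 xZ] cZ; apply: (series_le_cvg _ _ _ cZ) => n.
- by rewrite mulr_ge0 ?exprn_ge0.
- by rewrite mulr_ge0 ?exprn_ge0 ?(le_trans x0 xZ).
- by rewrite ler_wpM2l// lerXn2r ?nnegrE// (le_trans x0 xZ).
Qed.

Lemma psum_lipschitz a (x y Z : R) : (forall n, 0 <= a n) ->
  0 <= x -> x <= y -> y <= Z -> cvgn (series (fun n => a n * Z ^+ n)) ->
  0 <= psum a y - psum a x /\
  (psum a y - psum a x) * (Z - y) <= (y - x) * psum a Z.
Proof.
move=> a0 x0 xy yZ cZ; have y0 := le_trans x0 xy; have Z0 := le_trans y0 yZ.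
have cy : cvgn (series (fun n => a n * y ^+ n)).
  by apply: psum_cvg_le cZ => //; rewrite y0.
have cx : cvgn (series (fun n => a n * x ^+ n)).
  by apply: psum_cvg_le cZ => //; rewrite x0 (le_trans xy).
split.
  rewrite subr_ge0; apply: lim_series_le => // n.
  by rewrite ler_wpM2l// lerXn2r.
pose u n := (Z - y) * (a n * y ^+ n - a n * x ^+ n).
have uc : series u @ \oo --> (psum a y - psum a x) * (Z - y).
  rewrite mulrC; apply: cvg_seriesZ.
  rewrite (_ : series _ = series (fun n => a n * y ^+ n) -
     series (fun n => a n * x ^+ n)); first exact: cvgB.
  by rewrite -seriesN -seriesD.
have vc : series (fun n => (y - x) * (a n * Z ^+ n)) @ \oo --> (y - x) * psum a Z.
  exact: cvg_seriesZ.
apply: cvg_series_le uc vc => n.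
rewrite /u -mulrBr mulrCA [leRHS]mulrCA ler_wpM2l//.
rewrite mulrC (le_trans (subX_convex n x0 xy yZ))//.
by rewrite ler_wpM2l ?subr_ge0// gerBl exprn_ge0.
Qed.

Lemma psum_continuous a (x Z : R) : (forall n, 0 <= a n) ->
  0 < x < Z -> cvgn (series (fun n => a n * Z ^+ n)) ->
  {for x, continuous (psum a)}.
Proof.
move=> a0 /andP[x0 xZ] cZ.
(* Up to [Y] the distance to [Z] is at least [Z - Y], so a single Lipschitz constant serves near
   [x]. *)
pose Y := (x + Z) / 2.
have xY : x < Y by rewrite midf_lt.
have YZ : Y < Z by rewrite midf_lt.
pose C := psum a Z / (Z - Y).
have lip p q : 0 <= p -> p <= q -> q <= Y -> `|psum a q - psum a p| <= C * (q - p).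
  move=> p0 pq qY; have qZ : q <= Z by rewrite (le_trans qY)// ltW.
  have [ge0 le1] := psum_lipschitz a0 p0 pq qZ cZ.
  rewrite ger0_norm// /C mulrAC ler_pdivlMr ?subr_gt0// [leRHS]mulrC.
  rewrite (le_trans _ le1)// ler_wpM2l//.
  by rewrite lerD2l lerN2.
have lip' p : 0 <= p <= Y -> `|psum a x - psum a p| <= C * `|x - p|.
  move=> /andP[p0 pY]; have [xp|px] := leP x p.
    rewrite distrC (distrC x) (ger0_norm (_ : 0 <= p - x)) ?subr_ge0//.
    by apply: lip => //; exact: ltW.
  rewrite (ger0_norm (_ : 0 <= x - p)) ?subr_ge0 ?(ltW px)//.
  by apply: lip => //; rewrite ltW.
have C1 : 0 < `|C| + 1 by rewrite ltr_wpDl.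
apply/cvgrPdist_lt => e e0; have eC := divr_gt0 e0 C1; near=> p.
apply: (@le_lt_trans _ _ ((`|C| + 1) * `|x - p|)).
  apply: (le_trans (lip' _ _)).
    apply/andP; split.
      by apply: ltW; near: p; apply: (cvgr_gt x) => //; exact: cvg_id.
    by apply: ltW; near: p; apply: (cvgr_lt x) => //; exact: cvg_id.
  rewrite ler_wpM2r// (le_trans (ler_norm _))// lerDl//.
by rewrite mulrC -ltr_pdivlMr//; near: p; exact: cvgr_dist_lt.
Unshelve. all: by end_near. Qed.

End PowerSeries.

(** * The matrices A^*(w) *)

(* The level reached from level [K] by a jump [k], cut off at level 0. *)
Definition lev (K : nat) (k : int) : nat :=
  if (k + K%:Z)%R is Posz n then n else 0%N.

(** Row sums are the mean levels after one step from level [K >= 1]; for [K = 0] they are the mean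
    upward jumps. *)
Definition levmx (R : realType) m (A : int -> 'M[R]_m) (K : nat) : 'M[R]_m :=
  \matrix_(r, s) bilateral_sum (fun k => (lev K k)%:R * A k r s).

Lemma levP K k : 0 <= k + K%:Z /\ (lev K k)%:Z = k + K%:Z \/
  k + K%:Z < 0 /\ lev K k = 0%N.
Proof. by rewrite /lev; case: (k + K%:Z) => n; [left|right]. Qed.

Lemma levS_le K k : (lev K.+1 k <= (lev K k).+1)%N.
Proof. by have := levP K k; have := levP K.+1 k; lia. Qed.

Section Radius.
Context {R : realType} {m : nat}.
Implicit Types (A : int -> 'M[R]_m).

Lemma phiAplus_cvg A (w : R) : (forall k, nonneg_mx (A k)) ->
  0 <= w -> (w%:E < phiAplus A)%E ->
  exists Z, w < Z /\ forall r s, cvgn (series (fun n => A n%:Z r s * Z ^+ n)).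
Proof.
move=> A0 w0 wphi.
have Zrs (rs : 'I_m * 'I_m) : exists Z, w < Z /\
    cvgn (series (fun n => A n%:Z rs.1 rs.2 * Z ^+ n)).
  have : (w%:E < radius_of_convergence
      (fun n => if n is 0%N then 0%R else A n%:Z rs.1 rs.2))%E.
    have /bigmin_gtP[_ /(_ rs.1 isT)] := wphi.
    by move=> /bigmin_gtP[_ /(_ rs.2 isT)].
  move=> /ereal_sup_gt[_ [Z [Z0 cZ] <-]]; rewrite lte_fin => wZ.
  exists Z; split => //.
  (* The radius of convergence is taken without the term of index 0, which is put back here. *)
  pose u n := (if n is 0%N then 0 else A n%:Z rs.1 rs.2) * Z ^+ n.
  have ul : series u @ \oo --> limn (series u) by [].
  apply: (cvgP (A 0 rs.1 rs.2 + limn (series u))); rewrite -cvg_shiftS.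
  rewrite (_ : (fun n => _) = (fun n => A 0 rs.1 rs.2 + series u n.+1)).
    apply: cvgD; first exact: cvg_cst.
    by rewrite (cvg_shiftS (series u)).
  apply/funext => n; rewrite /series/= !big_nat_recl//= {1}/u mul0r add0r.
  by rewrite expr0 mulr1.
have /fin_all_exists[f fP] := Zrs.
exists (\big[Num.min/w + 1]_ij f ij); split.
  apply/bigmin_gtP; split=> [|ij _]; first by rewrite ltrDl.
  by have [] := fP ij.
move=> r s; have [_] := fP (r, s).
apply: psum_cvg_le => [n|]; first exact: A0.
rewrite bigmin_le andbT; apply/bigmin_geP; split=> [|ij _].
  by rewrite addr_ge0.
by have [/ltW/(le_trans w0)] := fP ij.
Qed.

End Radius.

Section StarMatrix.
Context {R : realType} {m : nat}.
Variables (A : int -> 'M[R]_m) (Z : R).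
Hypotheses (A0 : forall k, nonneg_mx (A k))
  (Abs : forall r s, is_bsum (fun k => A k r s) (Asum A r s))
  (Z1 : 1 < Z)
  (AZ : forall r s, cvgn (series (fun n => A n%:Z r s * Z ^+ n))).

Let Z0 : 0 < Z := lt_trans ltr01 Z1.

(** Equality if [k + K >= 0]; otherwise the left side is a negative power of [w] and the right side
    is 1. *)
Lemma exprz_lev_le (w : R) K k : 1 <= w -> w ^+ K * w ^ k <= w ^+ lev K k.
Proof.
move=> w1; have w0 : w != 0 by rewrite gt_eqF// (lt_le_trans ltr01).
rewrite exprnP -expfzDr// addrC /lev; case: (k + K%:Z) => n //.
by rewrite expr0 NegzE -exprnN invf_le1 ?exprn_ege1// exprn_gt0// (lt_le_trans ltr01).
Qed.

(** This is the common majorant for [Astar], the mean levels and the second-order remainders. For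
    negative [k] one has [lev K k <= K], so summability of the [A_k] suffices; otherwise the weight
    is [Z^K Z^k]. *)
Lemma bsum_lev_expr K r s : exists l, is_bsum (fun k => Z ^+ lev K k * A k r s) l.
Proof.
have [lp [ln [_ un _]]] := Abs r s.
have cn : cvgn (series (fun n => Z ^+ lev K (Negz n) * A (Negz n) r s)).
  have cu := cvgP _ (cvg_seriesZ (a := Z ^+ K) un).
  apply: (series_le_cvg _ _ _ cu) => n.
  - by rewrite mulr_ge0 ?exprn_ge0 ?(ltW Z0)//; exact: A0.
  - by rewrite mulr_ge0 ?exprn_ge0 ?(ltW Z0)//; exact: A0.
  - rewrite ler_wpM2r//; first exact: A0.
    by rewrite ler_weXn2l ?(ltW Z1)//; have := levP K (Negz n); lia.
have cp : cvgn (series (fun n => Z ^+ lev K n%:Z * A n%:Z r s)).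
  apply: (cvgP (Z ^+ K * limn (series (fun n => A n%:Z r s * Z ^+ n)))).
  rewrite (_ : (fun n => _ * _) = (fun n => Z ^+ K * (A n%:Z r s * Z ^+ n))).
    exact: cvg_seriesZ.
  apply/funext => n; rewrite (_ : lev K n%:Z = (K + n)%N) ?exprD; first by ring.
  by have := levP K n%:Z; lia.
by eexists; exists (limn (series (fun n => Z ^+ lev K n%:Z * A n%:Z r s))),
  (limn (series (fun n => Z ^+ lev K (Negz n) * A (Negz n) r s))).
Qed.

Lemma Astar_bsum w r s : 1 <= w <= Z ->
  is_bsum (fun k => w ^ k * A k r s) (Astar A w r s).
Proof.
move=> /andP[w1 wZ]; have w0 := lt_le_trans ltr01 w1.
have [l lE] := bsum_lev_expr 0 r s.
suff [l' l'E] : exists l', is_bsum (fun k => w ^ k * A k r s) l'.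
  by rewrite mxE (is_bsum_bilateral l'E).
apply: is_bsum_dom lE => k.
rewrite mulr_ge0 ?exprz_ge0 ?(ltW w0)//=; last exact: A0.
rewrite ler_wpM2r//; first exact: A0.
rewrite -[w ^ k]mul1r -(expr0 w) (le_trans (exprz_lev_le _ _ w1))//.
by rewrite lerXn2r// nnegrE ltW.
Qed.

Lemma levmx_bsum K r s :
  is_bsum (fun k => (lev K k)%:R * A k r s) (levmx A K r s).
Proof.
(* The factor comes from [n (Z - 1) <= Z^n]. *)
have [l /(is_bsumZ (Z - 1)^-1) lE] := bsum_lev_expr K r s.
suff [l' l'E] : exists l', is_bsum (fun k => (lev K k)%:R * A k r s) l'.
  by rewrite mxE (is_bsum_bilateral l'E).
apply: is_bsum_dom lE => k; rewrite mulr_ge0//=; last exact: A0.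
rewrite mulrA ler_wpM2r//; first exact: A0.
rewrite mulrC ler_pdivlMr ?subr_gt0//.
elim: (lev K k) => [|n IHn]; first by rewrite mul0r.
rewrite -addn1 natrD mulrDl exprD expr1.
have : 1 <= Z ^+ n by rewrite exprn_ege1// ltW.
move: IHn Z1; nra.
Qed.

Lemma levmx_ge0 K : nonneg_mx (levmx A K).
Proof.
move=> r s; apply: is_bsum_ge0 (levmx_bsum K r s) => k.
by rewrite mulr_ge0//; exact: A0.
Qed.

Lemma Astar_ge0 w : 1 <= w <= Z -> nonneg_mx (Astar A w).
Proof.
move=> wZ r s; apply: is_bsum_ge0 (Astar_bsum r s wZ) => k.
rewrite mulr_ge0 ?exprz_ge0//; last exact: A0.
by have /andP[/(le_trans ler01)] := wZ.
Qed.

(** The negative half is [w^-1] times a power series in [w^-1] that converges at 1, so [w > 1] puts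
    [w^-1] inside its disc. *)
Lemma Astar_continuous w r s : 1 < w < Z ->
  {for w, continuous (fun w => Astar A w r s)}.
Proof.
move=> /andP[w1 wZ]; have w0 := lt_trans ltr01 w1.
pose ap n := A n%:Z r s; pose an n := A (Negz n) r s.
have AE x : 1 < x < Z -> Astar A x r s = psum ap x + x^-1 * psum an x^-1.
  move=> /andP[x1 xZ].
  have x0 := lt_trans ltr01 x1.
  have xZ' : 1 <= x <= Z by rewrite !ltW.
  have [lp [ln [pl nl ->]]] := Astar_bsum r s xZ'; congr (_ + _).
    apply/esym/cvg_lim => //; apply: cvg_trans pl.
    rewrite (_ : (fun n => ap n * _) = fun n : nat => x ^ n%:Z * A n%:Z r s)//.
    by apply/funext => n; rewrite mulrC.
  have -> : psum an x^-1 = x * ln.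
    apply: cvg_lim => //; apply: cvg_trans (cvg_seriesZ (a := x) nl).
    rewrite (_ : (fun n => an n * _) = fun n => x * (x ^ Negz n * A (Negz n) r s))//.
    apply/funext => n; rewrite NegzE -exprnN exprS invfM mulrA.
    by rewrite mulrA divff ?gt_eqF// mul1r -exprVn mulrC.
  by rewrite mulKf// gt_eqF.
have cp : {for w, continuous (psum ap)}.
  by apply: (@psum_continuous _ ap w Z); [move=> n; exact: A0|rewrite w0|exact: AZ].
have cn : {for w^-1, continuous (psum an)}.
  apply: (@psum_continuous _ an w^-1 1) => [n||]; first exact: A0.
    by rewrite invr_gt0 w0 invf_lt1.
  have [lp [ln [_ nl _]]] := Abs r s; apply: (cvgP ln); apply: cvg_trans nl.
  by under eq_fun do rewrite expr1n mulr1.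
have wN0 : w != 0 by rewrite gt_eqF.
rewrite /prop_for /continuous_at AE ?w1//.
have vw : x^-1 @[x --> w] --> w^-1 by apply: cvgV => //; exact: cvg_id.
have cE : psum ap x + x^-1 * psum an x^-1 @[x --> w] -->
    psum ap w + w^-1 * psum an w^-1.
  by apply: cvgD; [exact: cp|apply: cvgM; [exact: vw|exact: (cvg_comp _ _ vw cn)]].
apply: cvg_trans cE.
apply: near_eq_cvg; near=> x; rewrite AE//; apply/andP; split; near: x.
  exact: (cvgr_gt w).
exact: (cvgr_lt w).
Unshelve. all: by end_near. Qed.

End StarMatrix.

(** * Negative drift *)

Section NegativeDrift.
Context {R : realType} {m : nat}.
Variables (A : int -> 'M[R]_m) (Z : R).
Hypotheses (A0 : forall k, nonneg_mx (A k))
  (Abs : forall r s, is_bsum (fun k => A k r s) (Asum A r s))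
  (Ast : stochastic_mx (Asum A))
  (Z1 : 1 < Z)
  (AZ : forall r s, cvgn (series (fun n => A n%:Z r s * Z ^+ n))).

(** [((1 + t)^n - 1 - n t) / t^2] is nondecreasing in [t], so its value at [t1] controls the
    remainder for all smaller [t]. *)
Lemma expr1D_taylor (t t1 : R) n : 0 <= t -> t <= t1 ->
  t1 ^+ 2 * ((1 + t) ^+ n - 1 - n%:R * t) <= t ^+ 2 * (1 + t1) ^+ n.
Proof.
move=> t0 tt1; have t10 := le_trans t0 tt1.
have D1 k : t1 * ((1 + t) ^+ k - 1) <= t * ((1 + t1) ^+ k - 1).
  have := @subX_convex R 1 (1 + t) (1 + t1) k ler01.
  by rewrite lerDl lerD2l expr1n => /(_ t0 tt1); lra.
suff : t1 ^+ 2 * ((1 + t) ^+ n - 1 - n%:R * t) <=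
       t ^+ 2 * ((1 + t1) ^+ n - 1 - n%:R * t1).
  move=> /le_trans; apply; rewrite ler_wpM2l ?exprn_ge0//.
  by rewrite -addrA gerDl -opprD oppr_le0 addr_ge0// mulr_ge0.
elim: n => [|n IHn]; first by rewrite !expr0 !subrr !mul0r !subr0 !mulr0.
have st (x : R) : (1 + x) ^+ n.+1 - 1 - n.+1%:R * x =
    ((1 + x) ^+ n - 1 - n%:R * x) + x * ((1 + x) ^+ n - 1).
  by rewrite exprS -natr1; ring.
rewrite !st [leLHS]mulrDr [leRHS]mulrDr lerD//.
have := D1 n; move/(ler_wpM2l (mulr_ge0 t0 t10)).
by rewrite !expr2; lra.
Qed.

Lemma expr1D_ge (t : R) n : 0 <= t -> 1 + n%:R * t <= (1 + t) ^+ n.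
Proof.
move=> t0; elim: n => [|n IHn]; first by rewrite mul0r addr0.
have n0 : 0 <= n%:R * t by rewrite mulr_ge0.
by rewrite exprS -natr1; move: IHn t0 n0; nra.
Qed.

(* First-order perturbation: the test vector is [1 + t h], with [h] solving the
   Poisson equation for the drift. *)
Lemma negative_drift_contractive K (h : 'cV[R]_m) (d : R) : d < 0 ->
  (forall r, \sum_s levmx A K r s - K%:R + (Asum A *m h) r 0 - h r 0 = d) ->
  exists t0, [/\ 0 < t0, t0 <= Z - 1 &
    forall t, 0 < t <= t0 -> contractive (Astar A (1 + t))].
Proof.
move=> d0 hd; pose t1 := Z - 1.
have t10 : 0 < t1 by rewrite subr_gt0.
have ZE : 1 + t1 = Z by rewrite addrC subrK.
have A_ge0 := Ast.1.
pose L := levmx A K; have L0 : nonneg_mx L := levmx_ge0 A0 Abs Z1 AZ K.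
pose E : 'M[R]_m := \matrix_(r, s) bilateral_sum (fun k => Z ^+ lev K k * A k r s).
have EE r s : is_bsum (fun k => Z ^+ lev K k * A k r s) (E r s).
  have [l lE] := bsum_lev_expr A0 Abs Z1 AZ K r s.
  by rewrite mxE (is_bsum_bilateral lE).
have E0 : nonneg_mx E.
  move=> r s; apply: is_bsum_ge0 (EE r s) => k.
  by rewrite mulr_ge0 ?exprn_ge0 ?(ltW (lt_trans ltr01 Z1))//; exact: A0.
pose e r s := E r s / t1 ^+ 2.
have e0 r s : 0 <= e r s by rewrite divr_ge0 ?exprn_ge0 ?(ltW t10)//; exact: E0.
pose G r := \sum_s (L r s * `|h s 0| + e r s * (1 + t1 * `|h s 0|)).
have G0 r : 0 <= G r.
  rewrite sumr_ge0// => s _; have := L0 r s; have := e0 r s => es Ls.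
  by rewrite addr_ge0// mulr_ge0// addr_ge0// mulr_ge0// ltW.
(* [K.+1] covers the term [K h t^2] of [(1 + K t) v] and one more [|h|] for the positivity of [v].
   The latter follows from [t D <= 1], while [t D <= - d] keeps the errors of order [t^2] below the
   gain [- d t]. *)
pose D := 1 + \sum_r (G r + K.+1%:R * `|h r 0|).
have D_gt0 : 0 < D.
  by rewrite /D ltr_pwDl// sumr_ge0// => r _; rewrite addr_ge0// mulr_ge0.
have Dr r : G r + K%:R * `|h r 0| + `|h r 0| < D.
  rewrite -addrA -[in X in _ + (_ + X)](mul1r `|h r 0|) -mulrDl natr1 /D.
  rewrite (bigD1 r)//= ltr_pwDl// lerDl sumr_ge0// => s _.
  by rewrite addr_ge0// mulr_ge0.
have DG r : G r + K%:R * `|h r 0| < D.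
  by rewrite (le_lt_trans _ (Dr r))// lerDl.
have Dh r : `|h r 0| < D.
  by rewrite (le_lt_trans _ (Dr r))// lerDr addr_ge0// mulr_ge0.
pose t0 := Num.min t1 (Num.min 1 (- d) / D).
have min_gt0 : 0 < Num.min 1 (- d) by rewrite lt_min ltr01 oppr_gt0.
exists t0; split; first by rewrite lt_min t10 divr_gt0.
  by rewrite ge_min lexx.
move=> t /andP[t_gt0]; rewrite le_min => /andP[tt1].
rewrite ler_pdivlMr// le_min => /andP[tD1 tDd].
have t_ge0 := ltW t_gt0.
pose v : 'cV[R]_m := \col_r (1 + t * h r 0).
have v0 r : 0 < v r 0.
  rewrite mxE; have := ler_norm (- h r 0); rewrite normrN => hr.
  by have := Dh r; move: hr tD1 t_gt0; nra.
exists v => // r.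
have w1 : 1 <= 1 + t <= Z by rewrite lerDl t_ge0 -ZE lerD2l.
(* This factor turns jumps into cut-off levels, so that downward jumps of infinite mean do no harm
   to the expansion in [t]. *)
have wK0 : 0 < (1 + t) ^+ K by rewrite exprn_gt0// ltr_wpDr.
rewrite -(ltr_pM2l wK0) mxE mulr_sumr.
have le1 s : (1 + t) ^+ K * Astar A (1 + t) r s <=
    Asum A r s + t * L r s + t ^+ 2 * e r s.
  have := is_bsumD (is_bsumD (Abs r s) (is_bsumZ t (levmx_bsum A0 Abs Z1 AZ K r s)))
    (is_bsumZ (t ^+ 2 / t1 ^+ 2) (EE r s)).
  rewrite /e [E r s / _]mulrC mulrA.
  apply: is_bsum_le (is_bsumZ _ (Astar_bsum A0 Abs Z1 AZ r s w1)) => k.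
  rewrite [leRHS](_ : _ = (1 + t * (lev K k)%:R + t ^+ 2 / t1 ^+ 2 * Z ^+ lev K k) *
    A k r s); last by ring.
  rewrite mulrA ler_wpM2r//; first exact: A0.
  have w1' : 1 <= 1 + t by rewrite lerDl.
  rewrite (le_trans (exprz_lev_le K k w1'))//.
  rewrite -lerBlDl mulrAC ler_pdivlMr ?exprn_gt0// -ZE.
  have := expr1D_taylor (lev K k) t_ge0 tt1.
  by lra.
apply: (@le_lt_trans _ _
   (\sum_s Asum A r s + t * \sum_s L r s + t * (Asum A *m h) r 0 + t ^+ 2 * G r)).
  rewrite [(Asum A *m h) r 0]mxE /G !mulr_sumr -!big_split/= ler_sum// => s _.
  rewrite mulrA [v s 0]mxE.
  have vs : 0 <= 1 + t * h s 0 by have := v0 s; rewrite mxE => /ltW.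
  rewrite (le_trans (ler_wpM2r vs (le1 s)))//.
  have Lh : L r s * h s 0 <= L r s * `|h s 0| by rewrite ler_wpM2l// ?L0// ler_norm.
  have eh : e r s * (1 + t * h s 0) <= e r s * (1 + t1 * `|h s 0|).
    rewrite ler_wpM2l// lerD2l.
    by rewrite (le_trans (ler_wpM2l t_ge0 (ler_norm _)))// ler_wpM2r.
  have t20 : 0 <= t ^+ 2 by rewrite exprn_ge0.
  have := ler_wpM2l t20 Lh; have := ler_wpM2l t20 eh.
  by rewrite expr2; lra.
rewrite Ast.2; apply: (@lt_le_trans _ _ ((1 + K%:R * t) * v r 0)); last first.
  by rewrite ler_wpM2r ?expr1D_ge// ltW.
rewrite [v r 0]mxE.
have Khr : - (K%:R * `|h r 0|) <= K%:R * h r 0.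
  by rewrite -mulrN ler_wpM2l// lerNl -normrN ler_norm.
have t20 : 0 < t ^+ 2 by rewrite exprn_gt0.
have := hd r; rewrite -/L => hr.
have tlt : t * (G r + K%:R * `|h r 0|) < - d.
  by rewrite (lt_le_trans _ tDd)// ltr_pM2l.
have := ler_wpM2l (ltW t20) Khr.
have : t * (t * (G r + K%:R * `|h r 0|)) < t * - d by rewrite ltr_pM2l.
have : t * d = t * (\sum_s L r s - K%:R + (Asum A *m h) r 0 - h r 0) by rewrite hr.
by rewrite !expr2; lra.
Qed.

End NegativeDrift.

(** * Subharmonic functions of a positive recurrent chain *)

Section EsumFacts.
Context {R : realType} {T : choiceType}.
Implicit Types (a : T -> \bar R) (A X : set T).
Local Open Scope ereal_scope.

Lemma esumZl_le A a (c : R) : (0 <= c)%R -> (forall i, 0 <= a i) ->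
  \esum_(i in A) (c%:E * a i) <= c%:E * \esum_(i in A) a i.
Proof.
move=> c0 a0; apply: ge_ereal_sup => _ [X [fX XA] <-].
rewrite -ge0_mule_fsumr//; apply: lee_pmul => //; first by rewrite fsume_ge0.
by apply: ereal_sup_ubound; exists X.
Qed.

Lemma esumZl A a (c : R) : (0 <= c)%R -> (forall i, 0 <= a i) ->
  \esum_(i in A) (c%:E * a i) = c%:E * \esum_(i in A) a i.
Proof.
move=> c0 a0; apply/eqP; rewrite eq_le esumZl_le//=.
have [->|cN0] := eqVneq c 0%R.
  by rewrite mul0e esum_ge0// => i _; rewrite mul0e.
have cp : (0 < c)%R by rewrite lt_neqAle eq_sym cN0.
rewrite muleC -lee_pdivlMr//.
have := @esumZl_le A (fun i => c%:E * a i) c^-1.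
rewrite invr_ge0 => /(_ c0) h.
rewrite muleC; apply: le_trans (h _); last by move=> i; rewrite mule_ge0.
by apply: le_esum => i _; rewrite muleA -EFinM mulVf// mul1e.
Qed.

Lemma esum_term_le A a t : (forall i, 0 <= a i) -> A t ->
  a t <= \esum_(i in A) a i.
Proof.
move=> a0 At; rewrite -[leLHS](esum_set1 (a0 t)).
rewrite [leRHS](esumID [set t])// setIC [A `&` _]setIC.
rewrite (_ : [set t] `&` A = [set t]); last by apply/seteqP; split=> x [] //= ->.
by rewrite leeDl// esum_ge0.
Qed.

Lemma esum_subset_le A X a : (forall i, 0 <= a i) -> X `<=` A ->
  \esum_(i in X) a i <= \esum_(i in A) a i.
Proof.
move=> a0 XA; rewrite [leRHS](esumID X)//.
by rewrite (setIidr XA) leeDl// esum_ge0.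
Qed.

End EsumFacts.

Section SubharmonicPosrec.
Context {R : realType} {T : choiceType}.
Variables (P : T -> T -> R) (x0 : T).
Hypotheses (Pst : stochastic_kernel P) (Pirr : irreducible_chain P)
  (Ppos : positive_recurrent P).
Implicit Types (F G : T -> \bar R).
Local Open Scope ereal_scope.

Let P0 x y : 0 <= (P x y)%:E. Proof. by rewrite lee_fin Pst.1. Qed.

(* Transitions killed on entering [x0]: [iter n taboo F x] is the expectation
   of [F] at time [n] on the event that [x0] is not visited at times 1..n. *)
Definition taboo F x := \esum_(w in [set w | w != x0]) ((P x w)%:E * F w).

Let surv n := iter n taboo (fun=> 1).

Lemma taboo_ge0 F x : (forall y, 0 <= F y) -> 0 <= taboo F x.
Proof. by move=> F0; apply: esum_ge0 => y _; rewrite mule_ge0. Qed.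

Lemma le_taboo F G x : (forall y, F y <= G y) -> taboo F x <= taboo G x.
Proof. by move=> FG; apply: le_esum => y _; rewrite lee_wpmul2l. Qed.

Lemma tabooD F G x : (forall y, 0 <= F y) -> (forall y, 0 <= G y) ->
  taboo (fun y => F y + G y) x = taboo F x + taboo G x.
Proof.
move=> F0 G0; rewrite /taboo -esumD; last 2 first.
- by move=> y _; rewrite mule_ge0.
- by move=> y _; rewrite mule_ge0.
by apply: eq_esum => y _; rewrite ge0_muleDr.
Qed.

Lemma taboo_sum (F : nat -> T -> \bar R) n x : (forall k y, 0 <= F k y) ->
  taboo (fun y => \sum_(k < n) F k y) x = \sum_(k < n) taboo (F k) x.
Proof.
move=> F0; elim: n => [|n IHn].
  rewrite big_ord0; apply: esum1 => y _; rewrite big_ord0 mule0//.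
rewrite big_ord_recr/= -IHn -tabooD//; last by move=> y; rewrite sume_ge0.
by congr taboo; apply/funext => y; rewrite big_ord_recr.
Qed.

Lemma iter_taboo_ge0 F n x : (forall y, 0 <= F y) -> 0 <= iter n taboo F x.
Proof.
by move=> F0; elim: n x => [//|n IHn] x /=; exact: taboo_ge0.
Qed.

Lemma le_iter_taboo F G n x : (forall y, F y <= G y) ->
  iter n taboo F x <= iter n taboo G x.
Proof. by move=> FG; elim: n x => [//|n IHn] x /=; exact: le_taboo. Qed.

Lemma iter_taboo_cst (c : R) n x : (0 <= c)%R ->
  iter n taboo (fun=> c%:E) x <= c%:E * surv n x.
Proof.
move=> c0; elim: n x => [|n IHn] x; first by rewrite /surv/= mule1.
rewrite iterS (le_trans (le_taboo _ IHn))// /surv iterS.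
rewrite -esumZl//; last first.
  by move=> y; rewrite mule_ge0// iter_taboo_ge0.
by apply: le_esum => y _; rewrite muleCA.
Qed.

Let surv_ge0 n x : 0 <= surv n x.
Proof. exact: iter_taboo_ge0. Qed.

Lemma surv1 x : 1 = taboo (fun=> 1) x + (P x x0)%:E.
Proof.
rewrite -[LHS](Pst.2 x) (esumID [set x0])//.
rewrite setTI esum_set1// addeC; congr (_ + _).
rewrite setTI (_ : ~` _ = [set w | w != x0]).
  by apply: eq_esum => y _; rewrite mule1.
by apply/seteqP; split=> y /= => [/eqP|/eqP].
Qed.

Let visit n := iter n taboo (fun y => (P y x0)%:E).

Let visit_ge0 n x : 0 <= visit n x.
Proof. exact: iter_taboo_ge0. Qed.

Lemma first_visit_taboo n x : first_visit P n x x0 = visit n x.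
Proof.
elim: n x => [//|n IHn] x; rewrite /visit iterS.
by apply: eq_esum => y _; congr (_ * _); exact: IHn.
Qed.

Lemma surv_visit n x : surv n x = surv n.+1 x + visit n x.
Proof.
elim: n x => [|n IHn] x; first exact: surv1.
rewrite {1}/surv iterS -/(surv n) (_ : surv n = fun y => surv n.+1 y + visit n y).
  by rewrite tabooD.
by apply/funext => y.
Qed.

Lemma surv_le1 n x : surv n x <= 1.
Proof.
elim: n => [//|n IHn]; apply: le_trans IHn.
by rewrite [leRHS]surv_visit leeDl.
Qed.

(** Summation by parts, from [surv k = surv k.+1 + visit k]. *)
Lemma surv_series n x : \sum_(k < n) surv k x =
  \sum_(k < n) (k.+1%:R%:E * visit k x) + n%:R%:E * surv n x.
Proof.
elim: n => [|n IHn]; first by rewrite !big_ord0 mul0e adde0.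
rewrite !big_ord_recr/= IHn -!addeA; congr (_ + _).
rewrite -[X in _ + X]mul1e -ge0_muleDl// -EFinD natr1.
rewrite -ge0_muleDr//; last exact: (surv_ge0 n.+1 x).
by congr (_ * _); rewrite addeC; exact: surv_visit.
Qed.

Definition mean_surv x := \sum_(0 <= n <oo) surv n x.

(** In the summation by parts the truncated mean is at most [M], and so is [n * surv n], which is
    compared with the tail of the series [M]. *)
Lemma mean_surv_x0 : mean_surv x0 < +oo.
Proof.
have [sum1 summ] := Ppos x0.
pose M := \sum_(0 <= n <oo) (n.+1%:R%:E * visit n x0).
have {}sum1 : \sum_(0 <= n <oo) visit n x0 = 1.
  by rewrite -sum1; apply: eq_eseriesr => n _; rewrite first_visit_taboo.
have {}summ : M < +oo.
  apply: le_lt_trans summ; apply: lee_nneseries => n _; first by rewrite mule_ge0.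
  by rewrite first_visit_taboo.
(* Recurrence enters here: the first-visit probabilities sum to 1, so no mass escapes. *)
have survE n : surv n x0 = \sum_(n <= k <oo) visit k x0.
  have fin : \sum_(0 <= k < n) visit k x0 \is a fin_num.
    rewrite ge0_fin_numE; last by rewrite sume_ge0.
    by rewrite (le_lt_trans (nneseries_lim_ge _ _))// sum1 ltry.
  rewrite -[LHS](addeK _ fin) -[RHS](addeK _ fin); congr (_ - _).
  rewrite addeC [RHS]addeC.
  transitivity (1 : \bar R); last first.
    by rewrite -sum1 (@nneseries_split _ _ 0 n)// add0n.
  elim: n {fin} => [|n IHn]; first by rewrite big_geq// add0e.
  by rewrite big_nat_recr//= -addeA [visit _ _ + _]addeC -surv_visit.
apply: (@le_lt_trans _ _ (M + M)); last by rewrite lte_add_pinfty.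
apply: lime_le; first exact: is_cvg_nneseries.
near=> n; rewrite big_mkord surv_series leeD//.
  rewrite -(big_mkord xpredT (fun k => k.+1%:R%:E * visit k x0)).
  by rewrite nneseries_lim_ge// => k _ _; rewrite mule_ge0.
rewrite survE -nneseriesZl//.
apply: (@le_trans _ _ (\sum_(n <= k <oo) (k.+1%:R%:E * visit k x0))).
  rewrite [leLHS]eseries_cond [leRHS]eseries_cond.
  apply: lee_nneseries => [k _ _|k /= nk]; first by rewrite mule_ge0.
  by rewrite lee_wpmul2r// lee_fin ler_nat ltnW.
rewrite /M (@nneseries_split _ _ 0 n) ?add0n; last first.
  by move=> k _; rewrite mule_ge0.
by rewrite leeDr// sume_ge0// => k _; rewrite mule_ge0.
Unshelve. all: by end_near. Qed.

(** A step from [y] to [w != x0] gives [P y w * mean_surv w <= mean_surv y], so finiteness spreads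
    from [x0] along paths of positive probability. *)
Lemma mean_surv_fin x : mean_surv x < +oo.
Proof.
have step y w : mean_surv y < +oo -> (0 < P y w)%R -> mean_surv w < +oo.
  move=> Uy Pyw; have [->|wx0] := eqVneq w x0; first exact: mean_surv_x0.
  have : (P y w)%:E * mean_surv w <= mean_surv y.
    rewrite /mean_surv -nneseriesZl//.
    rewrite [leRHS]nneseries_recl// (le_trans _ (leeDr _ _))//.
    rewrite -(nneseries_addn (f := surv ^~ y))//.
    apply: lee_nneseries => n _; first by rewrite mule_ge0.
    rewrite addn1 /surv iterS.
    by apply: (esum_term_le (fun z => mule_ge0 (P0 y z) (surv_ge0 n z))).
  move=> /le_lt_trans/(_ Uy).
  by case: (mean_surv w) => [r|//|//]; rewrite ?ltry// muleC gt0_mulye.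
have [n] := Pirr x0 x.
have {step} : forall y, mean_surv y < +oo -> 0 < nstep P n y x -> mean_surv x < +oo.
  elim: n => [|n IHn] y Uy /=.
    by rewrite lte_fin; case: eqVneq => [<-//|]; rewrite ltxx.
  move=> sum0; apply: contrapT => xoo; move: sum0.
  rewrite esum1 ?ltxx// => w _.
  have [Pyw|] := ltP 0%R (P y w); last first.
    by move=> P_le0; rewrite (@le_anti _ _ (P y w) 0%R) ?mul0e// P_le0 Pst.1.
  have nstep0 : 0 <= nstep P n w x.
    elim: (n) w {Pyw} => [|k IHk] w /=; first by rewrite lee_fin.
    by apply: esum_ge0 => z _; rewrite mule_ge0.
  have [|/eqP] := boolP (nstep P n w x == 0); first by move=> /eqP ->; rewrite mule0.
  move=> N0; case: xoo; apply: (IHn w); first exact: step Pyw.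
  by rewrite lt_neqAle nstep0 eq_sym andbT; apply/eqP.
by apply; exact: mean_surv_x0.
Qed.

Lemma near_finite (X : set T) (Q : nat -> T -> Prop) : finite_set X ->
  (forall y, X y -> \forall N \near \oo, Q N y) ->
  \forall N \near \oo, forall y, X y -> Q N y.
Proof.
move=> /finite_fsetP[Y ->] QY.
have h := filter_bigI eventually_filter (f := fun y N => Q N y) QY.
by apply: (@filterS _ _ eventually_filter _ _ _ h) => N hN y Yy; exact: hN.
Qed.

Definition vanishing (F : nat -> T -> \bar R) := forall x (e : R), (0 < e)%R ->
  \forall N \near \oo, F N x <= e%:E.

(** Dominated convergence: a finite set [X] carries all but [e1] of the mass of [P x]; convergence
    is uniform on [X], and the bound [C] serves outside. *)
Lemma vanishing_taboo (F : nat -> T -> \bar R) (C : R) : (0 <= C)%R ->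
  (forall N y, 0 <= F N y <= C%:E) -> vanishing F ->
  vanishing (fun N => taboo (F N)).
Proof.
move=> C0 FC vF x e e0.
have C1 : (0 < C + 1)%R by rewrite ltr_wpDl.
pose e1 := (e / (C + 1))%R.
have e10 : (0 < e1)%R by rewrite divr_gt0.
have e1E : (e1 + C * e1 = e)%R.
  by rewrite -[X in (X + _)%R]mul1r -mulrDl addrC mulrC divfK// gt_eqF.
have : (1 - e1)%:E < \esum_(y in [set: T]) (P x y)%:E.
  by rewrite Pst.2 lte_fin ltrBlDr ltrDl.
move=> /ereal_sup_gt[_ [X [fX _] <-]]; rewrite -esum_fset// => aX.
pose a := \esum_(y in X) (P x y)%:E; pose b := \esum_(y in ~` X) (P x y)%:E.
have ab : a + b = 1 by rewrite -(Pst.2 x) [RHS](esumID X)// !setTI.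
have a0 : 0 <= a by exact: esum_ge0.
have b0 : 0 <= b by exact: esum_ge0.
have a1 : a <= 1 by rewrite -ab leeDl.
have b1 : b <= e1%:E.
  move: aX ab b0; rewrite -/a; move: a0 a1; case: (a) => [r|//|//].
  case: (b) => [q|//|//]; rewrite !lee_fin lte_fin -EFinD => _ _ h [] h' _.
  by rewrite leNgt; apply/negP => ?; lra.
have : \forall N \near \oo, forall y, X y -> F N y <= e1%:E.
  by apply: near_finite => // y _; exact: vF.
apply: filterS => N FN.
apply: (@le_trans _ _ (\esum_(y in [set: T]) ((P x y)%:E * F N y))).
  by apply: esum_subset_le => // y; rewrite mule_ge0//; have /andP[] := FC N y.
rewrite (esumID X) ?setTI; last first.
  by move=> y _; rewrite mule_ge0//; have /andP[] := FC N y.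
rewrite -e1E EFinD; apply: leeD.
  apply: (@le_trans _ _ (e1%:E * a)).
    rewrite -esumZl ?(ltW e10)//; apply: le_esum => y Xy.
    by rewrite muleC lee_wpmul2r// FN.
  by rewrite -[leRHS]mule1 lee_wpmul2l// lee_fin ltW.
apply: (@le_trans _ _ (C%:E * b)).
  rewrite -esumZl//; apply: le_esum => y Xy.
  by rewrite muleC lee_wpmul2r//; have /andP[] := FC N y.
by rewrite EFinM lee_wpmul2l.
Qed.

(* The truncation [min f N] is subharmonic up to a deficit [d N] that is bounded
   by [C] and tends to 0 pointwise. Iterating the killed chain bounds
   [min f N] by the Green potential of [d N], which tends to 0 by dominated
   convergence, because the mean return times are finite. *)
Lemma subharmonic_eq0 (f : T -> R) (C : R) : (0 <= C)%R ->
  (forall x, 0 <= f x)%R -> f x0 = 0%R ->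
  (forall x, (f x)%:E <= \esum_(y in [set: T]) (P x y * f y)%:E) ->
  (forall x, \esum_(y in [set: T]) (P x y * Num.max 0 (f x - f y))%:E <= C%:E) ->
  forall x, f x = 0%R.
Proof.
move=> C0 f0 fx0 fsub fdec x.
pose g N y : R := Num.min (f y) N%:R.
have g0 N y : (0 <= g N y)%R by rewrite le_min f0 ler0n.
have Pg0 N y z : 0 <= (P y z * g N z)%:E by rewrite lee_fin mulr_ge0 ?Pst.1.
pose Pg N y := \esum_(z in [set: T]) (P y z * g N z)%:E.
have Pg_ge0 N y : 0 <= Pg N y by exact: esum_ge0.
have PgN N y : Pg N y <= N%:R%:E.
  rewrite -[leRHS]mule1 -(Pst.2 y) -esumZl//; apply: le_esum => z _.
  by rewrite -EFinM lee_fin mulrC ler_wpM2r ?Pst.1// ge_min lexx orbT.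
have Pg_fin N y : Pg N y \is a fin_num.
  by rewrite ge0_fin_numE// (le_lt_trans (PgN N y)) ?ltry.
pose d N y := maxe 0 ((g N y)%:E - Pg N y).
have d0 N y : 0 <= d N y by rewrite le_max lexx.
have gd N y : (g N y)%:E <= Pg N y + d N y.
  by rewrite -leeBlDl// le_max lexx orbT.
(* Truncating both values never enlarges a decrease from [y] to [z], so [fdec] bounds the
   deficit. *)
have dC N y : d N y <= C%:E.
  rewrite ge_max lee_fin C0/= leeBlDl//.
  have -> : (g N y)%:E = \esum_(z in [set: T]) (P y z * g N y)%:E.
    rewrite -[LHS]mule1 -(Pst.2 y) -esumZl//; apply: eq_esum => z _.
    by rewrite -EFinM mulrC.
  apply: le_trans (leeD (lexx (Pg N y)) (fdec y)).
  rewrite -esumD//; last first.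
    by move=> z _; rewrite lee_fin mulr_ge0 ?Pst.1// le_max lexx.
  apply: le_esum => z _; rewrite -EFinD lee_fin -mulrDr ler_wpM2l ?Pst.1//.
  rewrite /g; have := f0 y; have := f0 z.
  by case: (lerP (f y)); case: (lerP (f z)); case: (lerP 0%R (f y - f z)%R); lra.
(* Finitely many targets already carry more than [f y - e] of the expectation; once [N] exceeds [f]
   on them, truncation does not affect their share. *)
have vd : vanishing d.
  move=> y e e0.
  have : (f y - e)%:E < \esum_(z in [set: T]) (P y z * f z)%:E.
    by rewrite (lt_le_trans _ (fsub y))// lte_fin ltrBlDr ltrDl.
  move=> /ereal_sup_gt[_ [X [fX _] <-]]; rewrite -esum_fset// => [fX'|]; last first.
    by move=> z _; rewrite lee_fin mulr_ge0 ?Pst.1.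
  have : \forall N \near \oo, forall z, X z -> (f z <= N%:R)%R.
    by apply: near_finite => // z _; exact: nbhs_infty_ger.
  apply: filterS => N fN.
  rewrite ge_max lee_fin (ltW e0)/= leeBlDl//.
  rewrite -leeBlDr// -EFinB.
  apply: (@le_trans _ _ (f y - e)%:E).
    by rewrite lee_fin lerD2r ge_min lexx.
  apply: (le_trans (ltW fX')).
  apply: (@le_trans _ _ (\esum_(z in X) (P y z * g N z)%:E)); last first.
    exact: esum_subset_le.
  by apply: le_esum => z Xz; rewrite lee_fin ler_wpM2l ?Pst.1// le_min lexx fN.
have itd0 k N y : 0 <= iter k taboo (d N) y by exact: iter_taboo_ge0.
have itdC k N y : iter k taboo (d N) y <= C%:E * surv k y.
  exact: le_trans (le_iter_taboo _ _ (dC N)) (iter_taboo_cst _ _ C0).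
have vitd k : vanishing (fun N => iter k taboo (d N)).
  elim: k => [//|k IHk]; apply: (vanishing_taboo C0) IHk => N y.
  rewrite itd0/= (le_trans (itdC k N y))// -[leRHS]mule1 lee_wpmul2l//.
  exact: surv_le1.
(* Since [g N] vanishes at [x0], the full kernel may be replaced by the killed one in each step. *)
have gle N n y : (g N y)%:E <=
    \sum_(k < n) iter k taboo (d N) y + iter n taboo (fun z => (g N z)%:E) y.
  elim: n y => [|n IHn] y; first by rewrite big_ord0 add0e.
  apply: (le_trans (gd N y)).
  have -> : \sum_(k < n.+1) iter k taboo (d N) y =
      d N y + taboo (fun z => \sum_(k < n) iter k taboo (d N) z) y.
    rewrite big_ord_recl; congr (_ + _); rewrite taboo_sum => [|k z]; last exact: itd0.
    by apply: eq_bigr.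
  rewrite addeC -addeA leeD2l// iterS -tabooD; last 2 first.
  - by move=> z; rewrite sume_ge0// => k _; exact: itd0.
  - by move=> z; rewrite iter_taboo_ge0// => w; rewrite lee_fin.
  apply: le_trans (le_taboo _ IHn).
  rewrite /Pg (esumID [set x0])// setTI esum_set1// /g fx0.
  rewrite min_l ?ler0n// mulr0 add0e setTI /taboo.
  rewrite (_ : ~` _ = [set w | w != x0])//.
  by apply/seteqP; split=> z /= => [/eqP|/eqP].
have gN n N y : iter n taboo (fun z => (g N z)%:E) y <= N%:R%:E * surv n y.
  apply: le_trans (iter_taboo_cst _ _ _) => //.
  by apply: le_iter_taboo => z; rewrite lee_fin ge_min lexx orbT.
apply/eqP; rewrite eq_le f0 andbT; apply/ler_addgt0Pr => e e0; rewrite add0r.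
have e3 : (0 < e / 3)%R by rewrite divr_gt0.
have tail := nneseries_tail_cvg (mean_surv_fin x) (fun n _ => surv_ge0 n x).
have C1 : (0 < C + 1)%R by rewrite ltr_wpDl.
have eC : (0 < e / 3 / (C + 1))%R by rewrite divr_gt0.
have tail_le (r : R) : (0 < r)%R ->
    \forall n \near \oo, \sum_(n <= k <oo) surv k x <= r%:E.
  move=> r0; have /fine_cvgP[tfin tcvg] := tail.
  near=> n; rewrite -[leLHS]fineK; last by near: n.
  by rewrite lee_fin ltW//; near: n; exact: (cvgr_lt _ tcvg).
(* The order of choices matters: [K] makes the tail of the potential small uniformly in [N], then
   [N] settles the first [K] terms, and finally [n] makes [N * surv n] small. *)
have [K _ /(_ _ (leqnn K)) tailK] := tail_le _ eC.
have [N [fN dN]] : exists N, (f x <= N%:R)%R /\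
    \sum_(k < K) iter k taboo (d N) x <= (e / 3)%:E.
  have eK : (0 < e / 3 / K.+1%:R)%R by rewrite divr_gt0.
  have := filter_forall eventually_filter (fun k : 'I_K => vitd k x _ eK).
  have := nbhs_infty_ger (f x) => h1 h2.
  have [N _ /(_ _ (leqnn N)) [fN dN]] := filterI h1 h2.
  exists N; split=> //.
  apply: (@le_trans _ _ (\sum_(k < K) (e / 3 / K.+1%:R)%:E)); first exact: lee_sum.
  rewrite sumEFin lee_fin sumr_const card_ord -[leLHS]mulr_natr.
  rewrite -(mulrA (e / 3)%R) ler_piMr ?(ltW e3)//.
  by rewrite mulrC ler_pdivrMr// mul1r ler_nat.
have [n [Kn un]] : exists n, (K <= n)%N /\ N%:R%:E * surv n x <= (e / 3)%:E.
  have eN : (0 < e / 3 / N.+1%:R)%R by rewrite divr_gt0.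
  have [n0 _ Hn0] := tail_le _ eN.
  exists (maxn K n0); split; first exact: leq_maxl.
  set n := maxn K n0.
  have : surv n x <= (e / 3 / N.+1%:R)%:E.
    apply: le_trans (Hn0 n (leq_maxr _ _)).
    apply: (@le_trans _ _ (\sum_(n <= k < n.+1) surv k x)).
      by rewrite big_nat1.
    exact: nneseries_lim_ge.
  move=> /(lee_wpmul2l (_ : 0 <= N%:R%:E)) h; apply: (le_trans (h _)) => //.
  rewrite -EFinM lee_fin mulrCA ler_piMr ?(ltW e3)//.
  by rewrite ler_pdivrMr// mul1r ler_nat.
rewrite -lee_fin.
have := gle N n x; rewrite /g min_l// => /le_trans; apply.
have -> : e = (e / 3 + e / 3 + e / 3)%R by lra.
rewrite !EFinD; apply: leeD; last exact: le_trans (gN _ _ _) un.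
rewrite -(big_mkord xpredT (fun k => iter k taboo (d N) x)) (big_cat_nat _ Kn)//=.
rewrite big_mkord; apply: leeD => //.
apply: (@le_trans _ _ (C%:E * \sum_(K <= k <oo) surv k x)).
  apply: (@le_trans _ _ (\sum_(K <= k < n) (C%:E * surv k x))).
    by apply: lee_sum => k _; exact: itdC.
  by rewrite -ge0_sume_distrr// lee_wpmul2l// nneseries_lim_ge.
apply: (@le_trans _ _ (C%:E * (e / 3 / (C + 1))%:E)); first exact: lee_wpmul2l.
rewrite -EFinM lee_fin mulrA ler_pdivrMr// mulrC.
by rewrite ler_wpM2l ?(ltW e3)// lerDl.
Unshelve. all: by end_near. Qed.

End SubharmonicPosrec.

(** * The GI/G/1 chain *)

Section LevelChain.
Context {R : realType} {m : nat}.
Variables (A B : int -> 'M[R]_m).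
Hypotheses (A0 : forall k, nonneg_mx (A k))
  (Pst : stochastic_kernel (gig1_matrix A B)).

Lemma esum_levels (a : nat * 'I_m -> \bar R) : (forall y, (0 <= a y)%E) ->
  (\esum_(y in [set: nat * 'I_m]) a y =
   \sum_(0 <= k <oo) \sum_(l < m) a (k, l))%E.
Proof.
move=> a0.
have -> : [set: nat * 'I_m] = [set: nat] `*`` (fun=> [set: 'I_m]).
  by apply/seteqP; split.
have -> : (\esum_(y in [set: nat] `*`` (fun=> [set: 'I_m])) a y =
    \esum_(y in [set: nat] `*`` (fun=> [set: 'I_m])) a (y.1, y.2))%E.
  by apply: eq_esum => -[].
rewrite -(esum_esum (a := fun k l => a (k, l)))// -nneseries_esumT; last first.
  by move=> k; rewrite esum_ge0.
apply: eq_eseriesr => k _.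
rewrite esum_fset//; last exact: finite_finset.
  rewrite (fsbigE (index_enum 'I_m)) ?index_enum_uniq//.
    by apply: eq_bigl => l; rewrite in_setT.
  by move=> l _; rewrite mem_index_enum.
Qed.

(** Rows of the chain have mass 1, which bounds the sum of the [A_k] over any window: level 1 serves
    for [k >= 0], level [n + 1] for the indices from [-n] to [-1]. *)
Lemma Asum_bsum r s : is_bsum (fun k => A k r s) (Asum A r s).
Proof.
have row_le1 i n : \sum_(0 <= k < n) A (k%:Z - i%:Z) r s <= 1.
  have := Pst.2 (i.+1, r); rewrite esum_levels; last first.
    by move=> y; rewrite lee_fin Pst.1.
  move=> P1; rewrite -lee_fin -P1.
  have P0 k : (0 <= \sum_(l < m) (gig1_matrix A B (i.+1, r) (k, l))%:E)%E.
    by rewrite sume_ge0// => l _; rewrite lee_fin Pst.1.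
  apply: le_trans (nneseries_lim_ge n.+1 _) => //.
  rewrite big_nat_recl// -[leLHS]add0e leeD// -sumEFin lee_sum// => k _.
  rewrite (bigD1 s)//= -[leLHS]adde0 leeD//.
    by rewrite /gig1_matrix/= lee_fin (_ : k.+1%:Z - i.+1%:Z = k%:Z - i%:Z)//; lia.
  by rewrite sume_ge0// => l _; rewrite lee_fin Pst.1.
suff [l lE] : exists l, is_bsum (fun k => A k r s) l.
  by rewrite mxE (is_bsum_bilateral lE).
have cvg1 (u : nat -> R) : (forall n, 0 <= u n) -> (forall n, series u n <= 1) ->
    cvgn (series u).
  move=> u0 u1; apply: nondecreasing_is_cvgn.
    by apply/nondecreasing_seqP => n; rewrite /series/= big_nat_recr//= lerDl.
  by exists 1 => _ [n _ <-].
eexists; do 2 eexists; split; [| |reflexivity].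
  apply: cvg1 => n; first exact: A0.
  by have := row_le1 0%N n; rewrite /series/=; under eq_bigr do rewrite subr0.
apply: cvg1 => n; first exact: A0.
have := row_le1 n n; rewrite /series/= big_nat_rev/=.
apply: le_trans; rewrite le_eqVlt; apply/orP; left; apply/eqP.
by apply: eq_big_nat => k /andP[_ kn]; congr (A _ _ _); lia.
Qed.

(** As [F] vanishes at level 0, the blocks [B] drop out and the expectation is a sum over the jumps
    of [A] alone. *)
Lemma gig1_expectation i j (F : nat -> 'I_m -> R) (S : 'I_m -> R) :
  (forall k l, 0 <= F k l) -> (forall l, F 0%N l = 0) ->
  (forall l, is_bsum (fun k => A k j l * F (lev i.+1 k) l) (S l)) ->
  (\esum_(y in [set: nat * 'I_m])
     (gig1_matrix A B (i.+1, j) y * F y.1 y.2)%:E = (\sum_l S l)%:E)%E.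
Proof.
move=> F0 F00 FS.
rewrite esum_levels; last by move=> y; rewrite lee_fin mulr_ge0 ?Pst.1.
rewrite (nneseries_sum _ _) => [|l k _]; last first.
  by rewrite lee_fin mulr_ge0 ?Pst.1.
rewrite -sumEFin; apply: eq_bigr => l _.
have := FS l; move/(is_bsum_shift (i := i.+1)) => FSl.
have {}FSl : series (fun k => gig1_matrix A B (i.+1, j) (k, l) * F k l) @ \oo --> S l.
  apply: cvg_trans (FSl _); last first.
    by move=> k ki; rewrite (_ : lev _ _ = 0%N) ?F00 ?mulr0//; have := levP i.+1 k; lia.
  rewrite (_ : (fun k => _ * F k l) = fun k : nat => A (k%:Z - i.+1%:Z) j l *
    F (lev i.+1 (k%:Z - i.+1%:Z)) l)//.
  apply/funext => -[|k].
    rewrite (_ : lev _ _ = 0%N) ?F00 ?mulr0//.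
    by have := levP i.+1 (0%N%:Z - i.+1%:Z); lia.
  congr (_ * F _ _); last by have := levP i.+1 (k.+1%:Z - i.+1%:Z); lia.
rewrite -(cvg_lim _ FSl)// -EFin_lim; last exact: cvgP FSl.
by apply: congr_lim; apply/funext => n /=; rewrite /series/= -sumEFin.
Qed.

End LevelChain.

(** * Nonnegative drift excludes positive recurrence *)

Section NonnegativeDrift.
Context {R : realType} {m : nat}.
Variables (A B : int -> 'M[R]_m) (Z : R).
Hypotheses (m0 : (0 < m)%N) (A0 : forall k, nonneg_mx (A k))
  (Pst : stochastic_kernel (gig1_matrix A B))
  (Pirr : irreducible_chain (gig1_matrix A B))
  (Ppos : positive_recurrent (gig1_matrix A B))
  (Airr : irreducible_mx (Asum A)) (Ast : stochastic_mx (Asum A))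
  (Z1 : 1 < Z)
  (AZ : forall r s, cvgn (series (fun n => A n%:Z r s * Z ^+ n))).

Let Abs := Asum_bsum A0 Pst.

(* Mean increment of the level in one step from level [K >= 1]. *)
Definition drift K : 'cV[R]_m := \col_r (\sum_s levmx A K r s - K%:R).

(** [drift K] is the mean of [max k (- K)], which decreases with [K]. *)
Lemma driftS_le K r : drift K.+1 r 0 <= drift K r 0.
Proof.
rewrite !mxE -natr1 opprD addrA lerBlDr addrAC lerD2r.
rewrite -(Ast.2 r) -big_split/=; apply: ler_sum => s _.
have Lb := levmx_bsum A0 Abs Z1 AZ.
apply: is_bsum_le (Lb K.+1 r s) (is_bsumD (Lb K r s) (Abs r s)) => k.
rewrite -[X in _ + X]mul1r -mulrDl ler_wpM2r//; first exact: A0.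
by rewrite natr1 ler_nat levS_le.
Qed.

Lemma drift_limit (p : 'cV[R]_m) : (forall i, 0 < p i 0) ->
  (forall K, 0 <= \sum_r p r 0 * drift K r 0) ->
  exists b : 'cV[R]_m,
    (forall K r, b r 0 <= drift K r 0) /\ 0 <= \sum_r p r 0 * b r 0.
Proof.
move=> p0 pd.
have dni r : nonincreasing_seq (fun K => drift K r 0).
  by apply/nonincreasing_seqP => K; exact: driftS_le.
have dc r : cvgn (fun K => drift K r 0).
  apply: nonincreasing_is_cvgn => //.
  (* The other coordinates never exceed their values at [K = 0], so a nonnegative weighted sum
     bounds coordinate [r] from below. *)
  exists (- (\sum_(s < m | s != r) p s 0 * drift 0 s 0) / p r 0) => _ [K _ <-].
  rewrite ler_pdivrMr// mulrC lerNl.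
  have := pd K; rewrite (bigD1 r)//= -lerBlDl sub0r => /le_trans; apply.
  by apply: ler_sum => s _; rewrite ler_pM2l// dni.
exists (\col_r limn (fun K => drift K r 0)); split.
  by move=> K r; rewrite mxE; exact: nonincreasing_cvgn_ge.
have : (fun K => \sum_r p r 0 * drift K r 0) @ \oo -->
    \sum_r p r 0 * limn (fun K => drift K r 0).
  apply: cvg_big => [|r _]; first exact: add_continuous.
  by apply: cvgM; [exact: cvg_cst|exact: dc].
move=> pl; under eq_bigr do rewrite mxE.
rewrite -(cvg_lim _ pl)//; apply: limr_ge; first exact: cvgP pl.
by near=> K; exact: pd.
Unshelve. all: by end_near. Qed.

(* With [h <= 0] solving the Poisson equation, [max 0 (k + h l)] is subharmonic,
   vanishes at level 0 and is positive at high levels. *)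
Lemma nonnegative_drift_not_posrec (p : 'cV[R]_m) : (forall i, 0 < p i 0) ->
  \sum_i p i 0 = 1 -> (Asum A)^T *m p = p ->
  ~ (forall K, 0 <= \sum_r p r 0 * drift K r 0).
Proof.
move=> p0 p1 Ap /(drift_limit p0)[b [bd pb]].
have [h' h'E] := poisson_equation m0 Airr Ast b p0 p1 Ap.
have A_ge0 := Ast.1.
(* [A] fixes constants, so [h'] may be lowered by [H]; this gives [- 2 H <= h <= 0], and hence
   [F 0 = 0]. *)
pose H := \sum_r `|h' r 0|.
have h'H r : `|h' r 0| <= H.
  by rewrite /H (bigD1 r)//= lerDl sumr_ge0.
pose h : 'cV[R]_m := h' - const_mx H.
have h_le0 r : h r 0 <= 0.
  by rewrite !mxE subr_le0 (le_trans (ler_norm _)).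
have h_ge r : - (2 * H) <= h r 0.
  by have := h'H r; rewrite !mxE ler_norml; lra.
have H0 : 0 <= H by rewrite sumr_ge0.
have hE r : h r 0 <= b r 0 + (Asum A *m h) r 0.
  have -> : (Asum A *m h) r 0 = (Asum A *m h') r 0 - H.
    rewrite /h -[const_mx H](_ : H *: const_mx 1 = _); last first.
      by apply/matrixP => i j; rewrite !mxE mulr1.
    by rewrite mulmxBr -scalemxAr stochastic_mul1// !mxE mulr1.
  have -> : h r 0 = h' r 0 - H by rewrite !mxE.
  by have := h'E r; move: pb; lra.
pose F (k : nat) (l : 'I_m) : R := Num.max 0 (k%:R + h l 0).
have F0 k l : 0 <= F k l by rewrite le_max lexx.
have F00 l : F 0%N l = 0 by rewrite /F add0r max_l.
have F_ge k l : k%:R + h l 0 <= F k l by rewrite le_max lexx orbT.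
have F_le k l : F k l <= k%:R.
  by rewrite ge_max ler0n/= gerDl.
have Lb := levmx_bsum A0 Abs Z1 AZ.
pose f (y : nat * 'I_m) := F y.1 y.2.
pose C := \sum_r (2 * H + \sum_s levmx A 0 r s + `|b r 0|).
have C_ge r : 2 * H + \sum_s levmx A 0 r s - b r 0 <= C.
  have L0 q : 0 <= \sum_s levmx A 0 q s.
    by rewrite sumr_ge0// => s _; exact: (levmx_ge0 A0 Abs Z1 AZ).
  rewrite /C [leRHS](bigD1 r)//= -[leLHS]addr0 lerD//.
    by rewrite lerD2l -normrN ler_norm.
  by rewrite sumr_ge0// => q _; rewrite !addr_ge0// mulr_ge0.
have C0 : 0 <= C.
  rewrite sumr_ge0// => q _; rewrite !addr_ge0// ?mulr_ge0// sumr_ge0// => s _.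
  exact: (levmx_ge0 A0 Abs Z1 AZ).
have Pf0 x y : (0 <= (gig1_matrix A B x y * f y)%:E)%E.
  by rewrite lee_fin mulr_ge0 ?Pst.1//; exact: F0.
have fsub x : ((f x)%:E <= \esum_(y in [set: nat * 'I_m])
    (gig1_matrix A B x y * f y)%:E)%E.
  case: x => [[|i] j]; first by rewrite /f/= F00 esum_ge0.
  have /fin_all_exists[S SE] : forall l, exists S : R,
      is_bsum (fun k => A k j l * F (lev i.+1 k) l) S.
    move=> l; apply: is_bsum_dom (Lb i.+1 j l) => k.
    by rewrite mulr_ge0 ?A0//= mulrC ler_wpM2r// A0.
  rewrite (gig1_expectation Pst F0 F00 SE) lee_fin /f/= /F ge_max.
  have S0 l : 0 <= S l.
    by apply: is_bsum_ge0 (SE l) => k; rewrite mulr_ge0// A0.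
  rewrite sumr_ge0//=.
  apply: (@le_trans _ _ (\sum_l (levmx A i.+1 j l + Asum A j l * h l 0))).
    have := bd i.+1 j; have := hE j.
    rewrite [(Asum A *m h) _ _]mxE [drift _ _ _]mxE big_split/=.
    lra.
  apply: ler_sum => l _; rewrite [Asum A j l * _]mulrC.
  apply: is_bsum_le (is_bsumD (Lb i.+1 j l) (is_bsumZ (h l 0) (Abs j l))) (SE l) => k.
  by rewrite [h l 0 * _]mulrC [_%:R * _]mulrC -mulrDr ler_wpM2l ?F_ge// A0.
have fdec x : (\esum_(y in [set: nat * 'I_m])
    (gig1_matrix A B x y * Num.max 0 (f x - f y))%:E <= C%:E)%E.
  case: x => [[|i] j].
    rewrite esum1 ?lee_fin// => y _.
    by rewrite {1}/f/= F00 sub0r max_l ?mulr0// oppr_le0; exact: F0.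
  set x := (i.+1, j).
  pose dec y := Num.max 0 (f x - f y).
  have dec0 y : 0 <= dec y by rewrite le_max lexx.
  (* In the mean this bounds the decrease by [2 H], plus the mean upward jump, minus the drift at
     [i.+1]. Since [b] is below every drift, the resulting bound [C] is independent of the level. *)
  have decE y : dec y + y.1%:R <= i.+1%:R + 2 * H + (y.1 - i.+1)%:R.
    have h1 := F_ge y.1 y.2; have h2 := F_le i.+1 j; have h3 := h_ge y.2.
    have h4 := F0 y.1 y.2.
    have [yi|iy] := leqP y.1 i.+1.
      rewrite (_ : (y.1 - i.+1)%N = 0%N) ?addr0; last by lia.
      have : y.1%:R <= i.+1%:R :> R by rewrite ler_nat.
      by move=> ?; rewrite /dec /f /x /= -lerBrDr ge_max; apply/andP; split; lra.
    rewrite natrB ?(ltnW iy)//.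
    have iy' : i.+1%:R <= y.1%:R :> R by rewrite ler_nat ltnW.
    by rewrite /dec /f /x /= -lerBrDr ge_max; apply/andP; split; lra.
  have Pk : (\esum_(y in [set: nat * 'I_m]) (gig1_matrix A B x y * y.1%:R)%:E =
      (\sum_l levmx A i.+1 j l)%:E)%E.
    apply: (gig1_expectation Pst (F := fun k _ => k%:R)) => // l.
    by apply: is_bsum_eq (Lb i.+1 j l) => k; rewrite mulrC.
  have Pki : (\esum_(y in [set: nat * 'I_m])
      (gig1_matrix A B x y * (y.1 - i.+1)%:R)%:E = (\sum_l levmx A 0 j l)%:E)%E.
    apply: (gig1_expectation Pst (F := fun k _ => (k - i.+1)%:R)) => // l.
    apply: is_bsum_eq (Lb 0%N j l) => k; rewrite mulrC; congr (_ * _%:R).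
    by have := levP 0 k; have := levP i.+1 k; lia.
  have P_ge0 y : 0 <= gig1_matrix A B x y by exact: Pst.1.
  have Pc : (\esum_(y in [set: nat * 'I_m])
      (gig1_matrix A B x y * (i.+1%:R + 2 * H))%:E = (i.+1%:R + 2 * H)%:E)%E.
    rewrite -[RHS]mule1 -(Pst.2 x) -esumZl//; last by rewrite addr_ge0// mulr_ge0.
    by apply: eq_esum => y _; rewrite -EFinM mulrC.
  have : (\esum_(y in [set: nat * 'I_m]) (gig1_matrix A B x y * dec y)%:E +
      (\sum_l levmx A i.+1 j l)%:E <=
      (i.+1%:R + 2 * H)%:E + (\sum_l levmx A 0 j l)%:E)%E.
    rewrite -Pk -Pki -Pc -!esumD//;
      try by move=> y _; rewrite lee_fin mulr_ge0// ?addr_ge0// ?mulr_ge0.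
    by apply: le_esum => y _; rewrite -!EFinD lee_fin -!mulrDr ler_wpM2l.
  rewrite -leeBrDr// => /le_trans; apply.
  rewrite -EFinD lee_fin (le_trans _ (C_ge j))//.
  by have := bd i.+1 j; rewrite [drift _ _ _]mxE; lra.
pose j0 := Ordinal m0.
have f0E : f (0%N, j0) = 0 by exact: F00.
have fz := subharmonic_eq0 Pst Pirr Ppos C0 (fun y => F0 y.1 y.2) f0E fsub fdec.
have [n _ /(_ _ (leqnn n))] := nbhs_infty_ger (2 * H + 1).
have := fz (n, j0); have := F_ge n j0; have := h_ge j0; rewrite /f/=.
by move=> h1 + h3; rewrite h3; lra.
Qed.

End NonnegativeDrift.

(** * Complex zeros of det(I - A^*(z)) *)

Section ComplexStar.
Context {R : realType} {m : nat}.
Local Open Scope complex_scope.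
Import Normc.

Lemma cvg_real_complex (u : nat -> R) (l : R) : u @ \oo --> l ->
  (fun n => (u n)%:C : R[i]^o) @ \oo --> (l%:C : R[i]^o).
Proof.
move=> ul; apply/cvgrPdist_lt => e e0.
have eE : e = (complex.Re e)%:C.
  by case: e e0 => a b; rewrite ltcE/= => /andP[/eqP -> _].
move: e0; rewrite eE ltcR => e0.
near=> n; rewrite -rmorphB/= normcE_norm ltcR.
rewrite -[normc _]/(Num.sqrt _) expr0n addr0 sqrtr_sqr.
by near: n; exact: cvgr_dist_lt.
Unshelve. all: by end_near. Qed.

Lemma lim_real_complex (v : nat -> R[i]) (u : nat -> R) (l : R) :
  (forall n, v n = (u n)%:C) -> u @ \oo --> l ->
  limn (v : nat -> R[i]^o) = l%:C.
Proof.
by move=> /funext -> /cvg_real_complex; apply: cvg_lim; exact: norm_hausdorff.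
Qed.

(* [limn] of a divergent sequence is the default point 0. *)
Lemma normc_lim_le (u : nat -> R[i]) (c : R) : (forall n, normc (u n) <= c) ->
  normc (limn (u : nat -> R[i]^o)) <= c.
Proof.
move=> uc; have c0 : 0 <= c := le_trans (normc_ge0 _) (uc 0%N).
have [cu|du] := pselect (cvgn (u : nat -> R[i]^o)); last first.
  by rewrite (dvgP du) normc0.
rewrite -lecR -normcE_norm; apply/ler_addgt0Pr => e e0.
have /cvgrPdist_lt/(_ _ e0)[n _ /(_ _ (leqnn n)) un] := cu.
rewrite -[X in `|X|](subrK (u n)) (le_trans (ler_normD _ _))// addrC lerD//.
  by rewrite normcE_norm lecR.
exact: ltW.
Qed.

Lemma normcX (z : R[i]) (n : nat) : normc (z ^+ n) = normc z ^+ n.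
Proof. by elim: n => [|n IHn]; rewrite ?normc1// !exprS normcM IHn. Qed.

Lemma normcXz (z : R[i]) (k : int) : normc (z ^ k) = normc z ^ k.
Proof. by case: k => n; rewrite ?normcX// !NegzE -!exprnN normcV normcX. Qed.

Variables (A : int -> 'M[R]_m).

Lemma AstarC_real w r s : is_bsum (fun k => w ^ k * A k r s) (Astar A w r s) ->
  AstarC A w%:C r s = (Astar A w r s)%:C.
Proof.
move=> [lp [ln [up un E]]]; rewrite E mxE /bilateral_sum rmorphD/=.
congr (_ + _).
  apply: (lim_real_complex _ up) => n; rewrite /series/= rmorph_sum/=.
  by apply: eq_bigr => k _; rewrite mxE rmorphM/= rmorphXn.
apply: (lim_real_complex _ un) => n; rewrite /series/= rmorph_sum/=.
apply: eq_bigr => k _; rewrite mxE rmorphM/=; congr (_ * _).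
by rewrite NegzE -!exprnN fmorphV rmorphXn.
Qed.

Lemma normc_AstarC_le (z : R[i]) r s : (forall k, nonneg_mx (A k)) ->
  is_bsum (fun k => normc z ^ k * A k r s) (Astar A (normc z) r s) ->
  normc (AstarC A z r s) <= Astar A (normc z) r s.
Proof.
move=> A0 [lp [ln [up un E]]]; rewrite E mxE /bilateral_sum.
have part (v : nat -> R[i]) (u : nat -> R) (l : R) :
    (forall n, normc (v n) = u n) -> series u @ \oo --> l ->
    normc (limn (series (v : nat -> R[i]^o))) <= l.
  move=> vu ul; apply: normc_lim_le => n.
  have u0 k : 0 <= u k by rewrite -vu normc_ge0.
  apply: (@le_trans _ _ (series u n)); last first.
    rewrite -(cvg_lim _ ul)//; apply: nondecreasing_cvgn_le; last exact: cvgP ul.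
    by apply/nondecreasing_seqP => i; rewrite /series/= big_nat_recr//= lerDl.
  rewrite /series/= !big_mkord (le_trans (normc_sum _))//.
  by apply: ler_sum => k _; rewrite vu.
rewrite (le_trans (le_normcD _ _))// lerD//.
  by apply: part up => n; rewrite normcM normcXz mxE normc_real//; exact: A0.
by apply: part un => n; rewrite normcM normcXz mxE normc_real//; exact: A0.
Qed.

End ComplexStar.

(** * Contractivity from just above 1 up to [eta] *)

Section BeyondOne.
Context {R : realType} {m : nat}.
Variables (A : int -> 'M[R]_m) (Z : R).
Hypotheses (A0 : forall k, nonneg_mx (A k))
  (Abs : forall r s, is_bsum (fun k => A k r s) (Asum A r s))
  (Z1 : 1 < Z)
  (AZ : forall r s, cvgn (series (fun n => A n%:Z r s * Z ^+ n))).

(** The terms are nonnegative and [w^k > 0], so [Astar A w] is positive wherever [Asum A] is. *)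
Lemma Astar_irreducible w : 1 <= w <= Z -> irreducible_mx (Asum A) ->
  irreducible_mx (Astar A w).
Proof.
move=> wZ; have w0 : 0 < w by case/andP: wZ => /(lt_le_trans ltr01).
have As := Astar_bsum A0 Abs Z1 AZ.
apply: irreducible_mx_support => [r s|r s|r s A_gt0].
- by apply: is_bsum_ge0 (Abs r s) => k; exact: A0.
- exact: (Astar_ge0 A0 Abs Z1 AZ).
rewrite ltNge; apply: contraTN A_gt0 => As0; rewrite -leNgt.
apply: is_bsum_le (Abs r s) is_bsum0 => k.
have := is_bsum_term_le k
  (fun k => mulr_ge0 (exprz_ge0 k (ltW w0)) (A0 k r s)) (As w r s wZ).
by move=> /le_trans/(_ As0); rewrite pmulr_rle0// exprz_gt0.
Qed.

(* The first point where contractivity fails is a zero of the determinant, and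
   domination by [A^*(|z|)] makes it the least element of [Omega]. *)
Lemma Astar_contractive z t0 : 0 < t0 ->
  (forall t, 0 < t <= t0 -> contractive (Astar A (1 + t))) ->
  1 < z -> z < Z -> (Z%:E <= phiAplus A)%E -> (z%:E < eta A)%E ->
  contractive (Astar A z).
Proof.
move=> t0_gt0 ct z1 zZ Zphi zeta.
have As := Astar_bsum A0 Abs Z1 AZ.
have cw w : 1 < w <= 1 + t0 -> contractive (Astar A w).
  move=> /andP[w1 wt]; rewrite -(subrK 1 w) addrC; apply: ct.
  by rewrite subr_gt0 w1/= lerBlDl.
(* The path has to start strictly above 1, where contractivity is supplied and [Astar A] is known to
   be continuous. *)
pose w1 := Num.min (1 + t0) z.
have w1_gt1 : 1 < w1 by rewrite lt_min ltrDl t0_gt0.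
have w1z : w1 <= z by rewrite ge_min lexx orbT.
have cw1 w : 1 < w <= w1 -> contractive (Astar A w).
  by rewrite /w1 le_min => /andP[h1 /andP[h2 _]]; apply: cw; rewrite h1.
apply: contrapT => ncz.
have inZ w : w1 <= w <= z -> 1 < w < Z.
  by move=> /andP[h1 h2]; rewrite (lt_le_trans w1_gt1 h1) (le_lt_trans h2 zZ).
have inZ' w : w1 <= w <= z -> 1 <= w <= Z.
  by move=> /inZ/andP[/ltW -> /ltW ->].
have [|||s [/andP[w1s sz] ds cs]] :=
  contractive_singular_path (N := Astar A) w1z _ _ _ ncz.
- by move=> t /inZ'; exact: (Astar_ge0 A0 Abs Z1 AZ).
- by move=> t r s /inZ; exact: (Astar_continuous A0 Abs Z1 AZ).
- by apply: cw1; rewrite w1_gt1 lexx.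
have s1 : 1 < s := lt_trans w1_gt1 w1s.
have sZ : s < Z := le_lt_trans sz zZ.
have s0 : 0 < s := lt_trans ltr01 s1.
have Omega_s : Omega A s%:C%C.
  split; first by rewrite normc_real ?ltW.
    by rewrite normc_real ?(ltW s0)// (lt_le_trans _ Zphi)// lte_fin.
  have -> : AstarC A s%:C%C = map_mx (real_complex R) (Astar A s).
    apply/matrixP => i j; rewrite [RHS]mxE; apply: AstarC_real; apply: As.
    by rewrite !ltW.
  by rewrite -(map_mx1 (real_complex R)) -map_mxB det_map_mx ds rmorph0.
have s_min y : Omega A y -> s <= Normc.normc y.
  move=> [y1 yphi dy]; rewrite leNgt; apply/negP => ys.
  have yZ : 1 <= Normc.normc y <= Z by rewrite (ltW y1) (le_trans (ltW ys))// ltW.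
  have cy : contractive (Astar A (Normc.normc y)).
    have [yw|wy] := leP (Normc.normc y) w1; first by apply: cw1; rewrite y1.
    by apply: cs; rewrite ltW.
  have yA i j : Normc.normc (AstarC A y i j) <= Astar A (Normc.normc y) i j.
    by apply: normc_AstarC_le => //; exact: As.
  have := contractive_det_neq0 (Astar_ge0 A0 Abs Z1 AZ yZ) cy yA.
  by rewrite dy eqxx.
(* The point [s] shows that [eta A] is not the default [+oo]; being minimal, it is at most
   [s <= z]. *)
have [t [_ _ tmin] etaE] : [set x%:E | x in
    [set x : R | [/\ 0 < x, Omega A x%:C%C &
                     forall y, Omega A y -> x <= Normc.normc y]]] (eta A).
  by apply: (@xgetI _ _ _ s%:E); exists s.
move: zeta; rewrite -etaE lte_fin ltNge => /negP; apply.
by rewrite (le_trans (tmin _ Omega_s))// normc_real// ltW.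
Qed.

End BeyondOne.

Theorem lemma2p3 (R : realType) (m : nat) (A B : int -> 'M[R]_m)
    (m_gt0 : (0 < m)%N)
    (A_ge0 : forall k, nonneg_mx (A k))
    (B_ge0 : forall k, nonneg_mx (B k))
    (P_stochastic : stochastic_kernel (gig1_matrix A B))
    (P_irreducible : irreducible_chain (gig1_matrix A B))
    (P_aperiodic : aperiodic_chain (gig1_matrix A B))
    (P_posrec : positive_recurrent (gig1_matrix A B))
    (A_irreducible : irreducible_mx (Asum A))
    (A_stochastic : stochastic_mx (Asum A))
    (phi_gt1 : (1 < phiAplus A)%E) :
  forall z : R, 1 < z -> (z%:E < mine (phiAplus A) (eta A))%E ->
    chi A z < 1 /\
    exists Y : 'cV[R]_m,
      (forall j, 1 <= Y j 0) /\ Astar A z *m Y = chi A z *: Y.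
Proof.
move=> z z1; rewrite lt_min => /andP[zphi zeta].
have Abs := Asum_bsum A_ge0 P_stochastic.
have [Z' [zZ' AZ']] := phiAplus_cvg A_ge0 (ltW (lt_trans ltr01 z1)) zphi.
(* [Z <= Z'] keeps the series convergent, and [Z <= phiAplus A] ensures that a zero of the
   determinant with modulus between 1 and [Z] belongs to [Omega A]. *)
have [Z [zZ ZZ' Zphi]] : exists Z, [/\ z < Z, Z <= Z' & (Z%:E <= phiAplus A)%E].
  case: (phiAplus A) zphi => [q|_|//]; last by exists Z'; rewrite leey.
  rewrite lte_fin => zq; exists (Num.min Z' q).
  by rewrite lt_min zZ' zq lee_fin !ge_min !lexx orbT.
have Z1 := lt_trans z1 zZ.
have AZ r s : cvgn (series (fun n => A n%:Z r s * Z ^+ n)).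
  apply: psum_cvg_le (AZ' r s) => [n|]; first exact: A_ge0.
  by rewrite ZZ' (le_trans ler01)// ltW.
have zZle : 1 <= z <= Z by rewrite !ltW.
apply: contractive_perron => //.
- exact: (Astar_ge0 A_ge0 Abs Z1 AZ).
- exact: (Astar_irreducible A_ge0 Abs Z1 AZ).
have [p [p0 p1 Ap]] := stationary_distribution m_gt0 A_irreducible A_stochastic.
have [K dK] : exists K, \sum_r p r 0 * drift A K r 0 < 0.
  apply: contrapT => nK.
  apply: (nonnegative_drift_not_posrec m_gt0 A_ge0 P_stochastic P_irreducible
    P_posrec A_irreducible A_stochastic Z1 AZ p0 p1 Ap) => K.
  by rewrite leNgt; apply/negP => dK; apply: nK; exists K.
have [h hE] := poisson_equation m_gt0 A_irreducible A_stochastic (drift A K) p0 p1 Ap.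
have hE' r : \sum_s levmx A K r s - K%:R + (Asum A *m h) r 0 - h r 0 =
    \sum_j p j 0 * drift A K j 0 by rewrite -(hE r) [drift _ _ _ _]mxE.
have [t0 [t0_gt0 _ ct]] :=
  negative_drift_contractive A_ge0 Abs A_stochastic Z1 AZ dK hE'.
exact: (Astar_contractive A_ge0 Abs Z1 AZ t0_gt0 ct z1 zZ Zphi zeta).
Qed.
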